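(* Let $M\ge 2$ and $n\ge 1$ be integers, let $\delta\in(0,1)$, let $(\mathcal X,\mu)$ be a measure space, and let $\mathcal P=\{p_1,\dots,p_M\}$ be a known class of arbitrary probability densities on $\mathcal X$ with respect to $\mu$. There exists a density estimator $\widehat p=\widehat p(X_1,\dots,X_n)$ such that for every $p^\star\in\mathcal P$, if $X_1,\dots,X_n$ are i.i.d. with density $p^\star$, then with probability at least $1-\delta$, $$\mathrm{KL}(p^\star,\widehat p)\le \min\left\{\frac{75\log(2M)\log(2/\delta)}{n},\ \log(M)\right\}.$$ Moreover, this bound is optimal, in the sense that there are $M$ distributions such that, when they are taken as the class $\mathcal P$, no estimator can perform better up to universal constant factors.
   Context: For probability densities $p,q$ on $(\mathcal X,\mu)$, $\mathrm{KL}(p,q)=\int_{\mathcal X}p\log(p/q)\,d\mu\in[0,+\infty]$ (equal to $+\infty$ if the distribution with density $p$ is not absolutely continuous with respect to the one with density $q$). A density estimator is a map from samples in $\mathcal X^n$ to probability densities on $(\mathcal X,\mu)$; it may depend on $p_1,\dots,p_M$, $n$ and $\delta$, but not on $p^\star$, and need not take values in $\mathcal P$. No assumption is made on the densities: ratios may be unbounded and supports may differ. $\log$ is the natural logarithm. The performance of an estimator in the optimality assertion is the bound on $\mathrm{KL}(p^\star,\widehat p)$ that it guarantees with probability at least $1-\delta$ for every $p^\star\in\mathcal P$.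
   Formalization: In the optimality assertion the constant factor is uniform in M, n and all δ ≤ δ0, for each fixed δ0 < 1, but may depend on δ0; a constant uniform over all δ in (0,1) is impossible (M = 2, n = 1, δ → 1: the best guarantee tends to 0 while the bound stays log 2). *)

(* Defs.v *)
From HB Require Import structures.
From mathcomp Require Import all_boot all_order all_algebra.
From mathcomp Require Import all_classical all_reals all_analysis.

Set Implicit Arguments.
Unset Strict Implicit.
Unset Printing Implicit Defensive.

Import Order.TTheory GRing.Theory Num.Theory.
Import numFieldNormedType.Exports.

Local Open Scope classical_set_scope.
Local Open Scope ring_scope.

Definition is_density (d : measure_display) (T : measurableType d)
    (R : realType) (mu : {measure set T -> \bar R}) (p : T -> R) : Prop :=
  [/\ measurable_fun setT p, (forall x, 0 <= p x)
    & (\int[mu]_x (p x)%:E = 1)%E].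

(* Meaningful on measurable sets only. *)
Definition density_law (d : measure_display) (T : measurableType d)
    (R : realType) (mu : {measure set T -> \bar R}) (p : T -> R) :
    set T -> \bar R :=
  fun A => (\int[mu]_(x in A) (p x)%:E)%E.

(* The library conventions [x / 0 = 0] and [ln 0 = 0] are harmless here: where
   [p x = 0] the integrand is 0, as it should be, and in the absolutely
   continuous case [q x = 0 < p x] only happens on a [mu]-null set.  For
   densities the negative part of the integrand has integral at most 1, so the
   integral is never of the form [+oo - +oo]. *)
Definition KL (d : measure_display) (T : measurableType d)
    (R : realType) (mu : {measure set T -> \bar R}) (p q : T -> R) : \bar R :=
  if `[< density_law mu p `<< density_law mu q >]
  then (\int[mu]_x (p x * ln (p x / q x))%:E)%E
  else +oo%E.

(* The product rule for the full family yields the one for every subfamily, by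
   taking [B i = setT] for the other indices. *)
Definition iid_with_density (d d' : measure_display) (T : measurableType d)
    (Omega : measurableType d') (R : realType)
    (mu : {measure set T -> \bar R}) (p : T -> R) (P : probability Omega R)
    (n : nat) (X : 'I_n -> {RV P >-> T}) : Prop :=
  (forall B : 'I_n -> set T, (forall i, measurable (B i)) ->
     P [set w | forall i, B i (X i w)] =
     (\prod_(i < n) P (X i @^-1` B i))%E) /\
  (forall (i : 'I_n) (A : set T), measurable A ->
     P (X i @^-1` A) = density_law mu p A).

(* The event need not be measurable: it has to contain a measurable event of
   probability at least [c]. *)
Definition with_probability_at_least (d : measure_display)
    (Omega : measurableType d) (R : realType) (P : probability Omega R)
    (c : R) (A : set Omega) : Prop :=
  exists E : set Omega, [/\ measurable E, E `<=` A & (c%:E <= P E)%E].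

(* No measurability in the sample is required: a map that achieves a guarantee
   (in the sense below) over a finite class can always be replaced by one that
   takes finitely many values, each on a measurable set, with the same
   guarantee. *)
Definition density_estimator (d : measure_display) (T : measurableType d)
    (R : realType) (mu : {measure set T -> \bar R}) (n : nat)
    (phat : n.-tuple T -> T -> R) : Prop :=
  forall x : n.-tuple T, is_density mu (phat x).

Definition guarantees (d : measure_display) (T : measurableType d)
    (R : realType) (mu : {measure set T -> \bar R}) (M n : nat)
    (p : 'I_M -> T -> R) (delta : R) (phat : n.-tuple T -> T -> R)
    (b : \bar R) : Prop :=
  forall (j : 'I_M) (d' : measure_display) (Omega : measurableType d')
    (P : probability Omega R) (X : 'I_n -> {RV P >-> T}),
  iid_with_density mu (p j) X ->
  with_probability_at_least P (1 - delta)
    [set w | (KL mu (p j) (phat [tuple X i w | i < n]) <= b)%E].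

Definition kl_rate (R : realType) (M n : nat) (delta : R) : R :=
  Num.min (75%:R * ln (2%:R * M%:R) * ln (2%:R / delta) / n%:R) (ln M%:R).

Definition distinct_laws (d : measure_display) (T : measurableType d)
    (R : realType) (mu : {measure set T -> \bar R}) (M : nat)
    (p : 'I_M -> T -> R) : Prop :=
  forall i j : 'I_M, i != j ->
  exists2 A : set T, measurable A & density_law mu (p i) A <> density_law mu (p j) A.

(* Main.v *)
(* Upper bound.  Cut the sample into k = O(log(2/delta)) blocks of m observations.
   Inside a block average the Bayes mixtures (uniform prior) computed from the
   first 0, 1, ..., m observations.  If l_t is minus the log of the posterior
   weight of the true density, then E[l_{t+1} | past] = l_t - KL(p, q_t), so the
   divergences telescope and the average has expected divergence at most
   log M / (m + 1).  The blocks are then aggregated by the POINTWISE MEDIAN of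
   their averages: for fixed p the integrand p log(p/q) - p + q of the divergence
   is quasi-convex in q, so at each point at least half of the blocks do at least
   as badly as the median.  Hence only a median-of-means type event is needed,
   which fails with probability at most 2^-k.  When the bound is log M, the
   uniform mixture suffices.

   Lower bound.  Put mass 1 - eps on a common point and eps on a private point of
   each density, with (1 - eps)^n > delta.  A sample made only of the common
   point is then compatible with the guarantee for all the densities at once, and
   some private point receives mass at most (1 - q(0))/M. *)
Require Import Defs.
From HB Require Import structures.
From mathcomp Require Import all_boot all_order all_algebra.
From mathcomp Require Import all_classical all_reals all_analysis measurable_realfun.
From mathcomp Require Import zify ring lra.

Set Implicit Arguments.
Unset Strict Implicit.
Unset Printing Implicit Defensive.

Import Order.TTheory GRing.Theory Num.Theory.
Import numFieldNormedType.Exports.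

Local Open Scope classical_set_scope.
Local Open Scope ring_scope.
(** * Laws of samples *)

Section density_probability.
Context d (T : measurableType d) (R : realType) (mu : {measure set T -> \bar R}).
Variables (p : T -> R) (dp : is_density mu p).
Local Open Scope ereal_scope.

Let mp : measurable_fun setT p. Proof. by case: dp. Qed.
Let p0 x : (0 <= p x)%R. Proof. by case: dp => _ + _; exact. Qed.

Let law0 : density_law mu p set0 = 0.
Proof. exact: integral_set0. Qed.

Let law_ge0 A : 0 <= density_law mu p A.
Proof. by apply: integral_ge0 => x _; rewrite lee_fin. Qed.

Let law_sigma_additive : semi_sigma_additive (density_law mu p).
Proof.
move=> F mF tF mUF; rewrite /density_law ge0_integral_bigcup//=.
- by apply: is_cvg_nneseries => n _ _; apply: integral_ge0 => x _; rewrite lee_fin.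
- by apply/measurable_EFinP; exact: measurable_funTS.
- by move=> x _; rewrite lee_fin.
Qed.

HB.instance Definition _ := isMeasure.Build _ _ _ (density_law mu p)
  law0 law_ge0 law_sigma_additive.

Let law_setT : density_law mu p setT = 1.
Proof. by case: dp. Qed.

HB.instance Definition _ := Measure_isProbability.Build _ _ _
  (density_law mu p) law_setT.

Definition density_probability : probability T R := density_law mu p.

Import HBNNSimple.

(** Since [mu] is an arbitrary measure, no Radon-Nikodym derivative is invoked: monotone
    approximation by simple functions reduces the formula to indicators, where it is the definition
    of [density_law]. *)
Lemma integral_density_probability (f : T -> \bar R) :
  measurable_fun setT f -> (forall x, 0 <= f x) ->
  \int[density_probability]_x f x = \int[mu]_x ((p x)%:E * f x).
Proof.
move=> mf f0; pose h := nnsfun_approx measurableT mf.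
have mpE : measurable_fun setT (fun x => (p x)%:E) by exact/measurable_EFinP.
transitivity (limn (fun n => \int[density_probability]_x (h n x)%:E)).
  rewrite -monotone_convergence//.
  - apply: eq_integral => y _; apply/esym/cvg_lim => //.
    exact: cvg_nnsfun_approx.
  - by move=> n; exact/measurable_EFinP/measurable_funP.
  - by move=> n y _; rewrite lee_fin.
  - by move=> y _ m n mn; rewrite lee_fin; exact/lefP/nd_nnsfun_approx.
transitivity (limn (fun n => \int[mu]_x ((p x)%:E * (h n x)%:E))); last first.
  rewrite -monotone_convergence//.
  - apply: eq_integral => y _; apply/cvg_lim => //.
    apply: cvgeZl => //; exact: cvg_nnsfun_approx.
  - move=> n; apply: emeasurable_funM => //.
    exact/measurable_EFinP/measurable_funP.
  - by move=> n y _; rewrite -EFinM lee_fin mulr_ge0.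
  - move=> y _ m n mn; rewrite lee_wpmul2l ?lee_fin//.
    exact/lefP/nd_nnsfun_approx.
congr (limn _); apply/funext => n.
under [LHS]eq_integral do rewrite fimfunE -fsumEFin//.
rewrite ge0_integral_fsum//; last 2 first.
  - by move=> y; exact/measurable_EFinP/measurable_funM.
  - by move=> y x _; rewrite nnfun_muleindic_ge0.
under [RHS]eq_integral => x _.
  rewrite fimfunE -fsumEFin// ge0_mule_fsumr; last first.
    by move=> r; exact: nnfun_muleindic_ge0.
  over.
rewrite ge0_integral_fsum//; last 2 first.
  - move=> r; apply: emeasurable_funM => //.
    by exact/measurable_EFinP/measurable_funM.
  - by move=> r x _; rewrite mule_ge0 ?lee_fin//; exact: nnfun_muleindic_ge0.
apply: eq_fsbigr => r _.
rewrite integralZl_indic_nnsfun// integral_indic//= setIT.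
under [RHS]eq_integral do rewrite EFinM muleCA.
(* A nonnegative simple function never takes a negative value [r], so its preimage is empty and both
   sides vanish. *)
have [r0|r0] := leP 0%R r; last first.
  rewrite preimage_nnfun0//; under eq_integral do rewrite indic0 !mule0.
  by rewrite integral0/= /density_law integral_set0 mule0.
rewrite ge0_integralZl//; last 2 first.
- apply: emeasurable_funM => //; exact/measurable_EFinP.
- by move=> x _; rewrite mule_ge0 ?lee_fin.
congr (_ * _); rewrite /density_law integral_mkcond/=.
by apply: eq_integral => x _; rewrite patchE indicE;
   case: ifPn => _; rewrite ?mule1 ?mule0.
Qed.

End density_probability.

Section iid_law.
Context d (T : measurableType d) (R : realType) (nu : probability T R).
Local Open Scope ereal_scope.

Definition tuple_cons n (z : T * n.-tuple T) : n.+1.-tuple T :=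
  [tuple of z.1 :: z.2].

Let measurable_tuple_cons n : measurable_fun setT (@tuple_cons n).
Proof. exact: measurable_cons. Qed.

HB.instance Definition _ n :=
  isMeasurableFun.Build _ _ _ _ (@tuple_cons n) (@measurable_tuple_cons n).

(** Defined by recursion on the first observation, so that expectations can be peeled off one
    observation at a time; both the telescoping of risks and the independence of blocks rest on
    this. *)
Fixpoint iid_law n : probability (n.-tuple T) R :=
  if n is n'.+1 then distribution (nu \x iid_law n')%E (@tuple_cons n')
  else (dirac [tuple] : probability _ R).

Lemma integral_iid_law0 (F : 0.-tuple T -> \bar R) :
  measurable_fun setT F -> \int[iid_law 0]_t F t = F [tuple].
Proof. by move=> mF; rewrite integral_dirac// diracT mul1e. Qed.

Lemma integral_iid_lawS n (F : n.+1.-tuple T -> \bar R) :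
  measurable_fun setT F -> (forall t, 0 <= F t) ->
  \int[iid_law n.+1]_t F t =
  \int[nu]_x \int[iid_law n]_t F [tuple of x :: t].
Proof.
move=> mF F0; rewrite [LHS]ge0_integral_distribution//.
rewrite fubini_tonelli1//=; first exact: measurableT_comp.
Qed.

Lemma measurable_tuple_box n (B : 'I_n -> set T) :
  (forall i, measurable (B i)) ->
  measurable [set t : n.-tuple T | forall i, B i (tnth t i)].
Proof.
move=> mB; rewrite (_ : mkset _ = \bigcap_(i in setT) (tnth (T:=T) ^~ i) @^-1` B i).
  apply: fin_bigcap_measurable => // i _; rewrite -[X in measurable X]setTI.
  exact: measurable_tnth.
by apply/seteqP; split => [t H i _|t H i]; [exact: H|apply: H => /=].
Qed.

Lemma iid_law_box n (B : 'I_n -> set T) : (forall i, measurable (B i)) ->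
  iid_law n [set t | forall i, B i (tnth t i)] = \prod_(i < n) nu (B i).
Proof.
elim: n B => [|n IHn] B mB.
  by rewrite big_ord0 /= diracE mem_set//= => -[].
rewrite big_ord_recl/= -IHn//.
rewrite /distribution/pushforward/= -product_measure1E//; last first.
  exact: (@measurable_tuple_box _ (fun i => B (lift ord0 i))).
congr (product_measure1 _ _ _); apply/seteqP; split => -[x t]/= H.
  split => [|i]; first exact: (H ord0).
  by have := H (lift ord0 i); rewrite tnthS.
move=> i; case: (unliftP ord0 i) => [j|] ->; last exact: H.1.
by rewrite tnthS; exact: H.2.
Qed.

Let box n : set_system (n.-tuple T) := [set A | exists2 B : 'I_n -> set T,
  (forall i, measurable (B i)) & A = [set t | forall i, B i (tnth t i)]].

Let measurable_box n : @measurable _ (n.-tuple T) = <<s @box n >>.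
Proof.
apply/seteqP; split.
  apply: smallest_sub; first exact: smallest_sigma_algebra.
  move=> A; rewrite -bigcup_seq/= => -[i _ [C mC <-]].
  apply: sub_sigma_algebra.
  exists (fun j => if j == i then C else setT) => [j|].
    by case: ifPn.
  rewrite setTI; apply/seteqP; split => [t Ct j|t /(_ i)]/=; last by rewrite eqxx.
  by case: eqVneq => [->|].
apply: smallest_sub; first exact: sigma_algebra_measurable.
move=> A [B mB ->].
exact: measurable_tuple_box.
Qed.

Let setI_closed_box n : setI_closed (@box n).
Proof.
move=> _ _ [B mB ->] [C mC ->]; exists (fun i => B i `&` C i).
  by move=> i; exact: measurableI.
apply/seteqP; split => [t [HB HC] i|t H]; first by split.
by split => i; case: (H i).
Qed.

(** Boxes are closed under intersection and generate the product sigma-algebra, so two probabilities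
    that agree on them are equal. *)
Lemma iid_law_unique n (Q : probability (n.-tuple T) R) :
  (forall B : 'I_n -> set T, (forall i, measurable (B i)) ->
     Q [set t | forall i, B i (tnth t i)] = \prod_(i < n) nu (B i)) ->
  forall A, measurable A -> Q A = iid_law n A.
Proof.
move=> HQ A mA; apply: (measure_unique (@box n) (fun=> setT)) => //.
- exact: measurable_box.
- exact: setI_closed_box.
- by move=> _; exists (fun=> setT) => //; apply/seteqP; split.
- by rewrite bigcup_const.
- move=> _ [B mB ->]; exact: etrans (HQ _ mB) (esym (iid_law_box mB)).
- by move=> _; apply: (le_lt_trans (probability_le1 _ _)) => //; exact: ltry.
Qed.

Lemma measurable_mktuple d' (Omega : measurableType d') n (X : 'I_n -> Omega -> T) :
  (forall i, measurable_fun setT (X i)) ->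
  measurable_fun setT (fun w => [tuple X i w | i < n]).
Proof.
move=> mX; apply/measurable_fun_tnthP => i; rewrite (_ : _ \o _ = X i)//.
by apply/funext => w /=; rewrite tnth_mktuple.
Qed.

(** Transfers expectations from the arbitrary sample space of the guarantee to the canonical law
    [iid_law]. *)
Lemma integral_iid d' (Omega : measurableType d') (P : probability Omega R)
    n (X : 'I_n -> {RV P >-> T}) :
  (forall B : 'I_n -> set T, (forall i, measurable (B i)) ->
     P [set w | forall i, B i (X i w)] = \prod_(i < n) nu (B i)) ->
  forall F : n.-tuple T -> \bar R, measurable_fun setT F -> (forall t, 0 <= F t) ->
  \int[P]_w F [tuple X i w | i < n] = \int[iid_law n]_t F t.
Proof.
move=> HX F mF F0.
have mX : measurable_fun setT (fun w => [tuple X i w | i < n]).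
  exact: measurable_mktuple.
pose Xt : {mfun Omega >-> n.-tuple T} := HB.pack (fun w => [tuple X i w | i < n])
  (isMeasurableFun.Build _ _ _ _ _ mX).
transitivity (\int[distribution P Xt]_t F t); first by rewrite ge0_integral_distribution.
apply: eq_measure_integral => A mA _.
apply: (iid_law_unique (Q := distribution P Xt)) => // B mB.
apply: etrans (HX _ mB); congr (P _).
apply/seteqP; split => w /= + i => /(_ i);
  by rewrite tnth_mktuple.
Qed.

End iid_law.

Section seq_measurable.
Context d (T : measurableType d).

(** Functions of samples are taken on lists, so that prefixes, suffixes and concatenations require
    no casts between tuple types; measurability is then asked for each length. *)
Definition seq_measurable d' (U : measurableType d') (F : seq T -> U) :=
  forall n, measurable_fun setT (fun t : n.-tuple T => F t).

Context d' (U : measurableType d').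
Implicit Types F : seq T -> U.

Lemma seq_measurable_take F m :
  seq_measurable F -> seq_measurable (fun s => F (take m s)).
Proof.
move=> mF n; apply: (measurableT_comp (f := fun t : (minn m n).-tuple T => F t)
  (g := fun t : n.-tuple T => [tuple of take m t]) (mF _)).
apply/measurable_fun_tnthP => i.
have mi : (i < n)%N by rewrite (leq_trans (ltn_ord i))// geq_minr.
rewrite (_ : _ \o _ = tnth (T:=T) ^~ (Ordinal mi));
  first exact: (@measurable_tnth _ T n (Ordinal mi)).
apply/funext => t /=; have x0 := tnth t (Ordinal mi).
rewrite !(tnth_nth x0)/= nth_take//.
by rewrite (leq_trans (ltn_ord i))// geq_minl.
Qed.

Lemma seq_measurable_drop F m :
  seq_measurable F -> seq_measurable (fun s => F (drop m s)).
Proof.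
move=> mF n; apply: (measurableT_comp (f := fun t : (n - m).-tuple T => F t)
  (g := fun t : n.-tuple T => [tuple of drop m t]) (mF _)).
apply/measurable_fun_tnthP => i.
have mi : (m + i < n)%N by rewrite -ltn_subRL.
rewrite (_ : _ \o _ = tnth (T:=T) ^~ (Ordinal mi));
  first exact: (@measurable_tnth _ T n (Ordinal mi)).
apply/funext => t /=; have x0 := tnth t (Ordinal mi).
by rewrite !(tnth_nth x0)/= nth_drop.
Qed.

Lemma measurable_seq_cons F n : seq_measurable F ->
  measurable_fun setT (fun z : T * n.-tuple T => F (z.1 :: z.2)).
Proof.
move=> mF; apply: (measurableT_comp (f := fun t : n.+1.-tuple T => F t)
  (g := @tuple_cons _ T n) (mF _)).
exact: measurable_cons.
Qed.

Lemma seq_measurable_cons F x :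
  seq_measurable F -> seq_measurable (fun s => F (x :: s)).
Proof.
move=> mF n.
apply: (measurableT_comp (f := fun z : T * n.-tuple T => F (z.1 :: z.2))
  (g := pair x)); first exact: measurable_seq_cons.
exact: pair1_measurable.
Qed.

Lemma seq_measurable_cat F u :
  seq_measurable F -> seq_measurable (fun s => F (u ++ s)).
Proof.
elim: u F => [|x u IHu] F mF //; apply: (IHu (fun s => F (x :: s))).
exact: seq_measurable_cons.
Qed.

End seq_measurable.

Section iid_expectation.
Context d (T : measurableType d) (R : realType) (nu : probability T R).
Local Open Scope ereal_scope.
Implicit Types F G : seq T -> \bar R.

Definition iidE n F := \int[iid_law nu n]_t F t.

Lemma iidE_ge0 n F : (forall s, 0 <= F s) -> 0 <= iidE n F.
Proof. by move=> F0; apply: integral_ge0. Qed.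

Lemma iidE0 F : seq_measurable F -> iidE 0 F = F [::].
Proof. by move=> mF; rewrite /iidE integral_iid_law0. Qed.

Lemma iidES n F : seq_measurable F -> (forall s, 0 <= F s) ->
  iidE n.+1 F = \int[nu]_x iidE n (fun s => F (x :: s)).
Proof. by move=> mF F0; rewrite /iidE integral_iid_lawS. Qed.

Lemma measurable_iidE_cons n F : seq_measurable F -> (forall s, 0 <= F s) ->
  measurable_fun setT (fun x => iidE n (fun s => F (x :: s))).
Proof.
move=> mF F0; exact: (measurable_fun_fubini_tonelli_F _
  (measurable_seq_cons (n := n) mF) (fun z => F0 (z.1 :: z.2))).
Qed.

Lemma iidE_cst n c : iidE n (fun=> c) = c.
Proof. by rewrite /iidE integral_cst// [X in _ * X]probability_setT mule1. Qed.

Lemma iidEZl n F c : seq_measurable F -> (forall s, 0 <= F s) -> 0 <= c ->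
  iidE n (fun s => c * F s) = c * iidE n F.
Proof. by move=> mF F0 c0; rewrite /iidE ge0_integralZl//; exact: mF. Qed.

Lemma iidE_split m n G F : seq_measurable G -> (forall s, 0 <= G s) ->
  seq_measurable F -> (forall s, 0 <= F s) ->
  iidE (m + n) (fun s => G (take m s) * F (drop m s)) = iidE m G * iidE n F.
Proof.
move=> + + mF F0; elim: m G => [|m IHm] G mG G0.
  rewrite iidE0// add0n -iidEZl//.
  by apply: eq_integral => t _; rewrite take0 drop0.
have mGF : seq_measurable (fun s => G (take m.+1 s) * F (drop m.+1 s)).
  move=> k; apply: emeasurable_funM.
    exact: (seq_measurable_take m.+1 mG).
  exact: (seq_measurable_drop m.+1 mF).
rewrite addSn iidES//; last by move=> s; rewrite mule_ge0.
under eq_integral => x _.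
  rewrite (IHm (fun s => G (x :: s)))//; last exact: seq_measurable_cons.
  over.
rewrite ge0_integralZr//; first by rewrite -iidES.
- exact: measurable_iidE_cons.
- by move=> x _; exact: iidE_ge0.
- exact: iidE_ge0.
Qed.

Definition block m (s : seq T) b := take m (drop (b * m) s).

Lemma seq_measurable_block d' (U : measurableType d') m b (F : seq T -> U) :
  seq_measurable F -> seq_measurable (fun s => F (block m s b)).
Proof.
move=> mF; rewrite /block.
exact: (seq_measurable_drop (F := fun s => F (take m s)) (b * m)
          (seq_measurable_take m mF)).
Qed.

Lemma seq_measurable_prod_block k m G : seq_measurable G ->
  seq_measurable (fun s => \prod_(b < k) G (block m s b)).
Proof.
move=> mG n; elim: k => [|k IHk].
  by under eq_fun do rewrite big_ord0; exact: measurable_cst.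
under eq_fun do rewrite big_ord_recr/=.
by apply: emeasurable_funM => //; exact: seq_measurable_block.
Qed.

(** Disjoint blocks are independent: [iidE_split] removes the first block and the induction handles
    the others. The last [r] observations lie in no block. *)
Lemma iidE_prod_block k m r G : seq_measurable G -> (forall s, 0 <= G s) ->
  iidE (k * m + r) (fun s => \prod_(b < k) G (block m s b)) = iidE m G ^+ k.
Proof.
move=> mG G0; elim: k => [|k IHk].
  under [LHS]eq_integral do rewrite big_ord0.
  by rewrite -[LHS]/(iidE _ (fun=> 1)) iidE_cst expe0.
rewrite expeS -IHk mulSn -addnA -iidE_split//.
- apply: eq_integral => t _; rewrite big_ord_recl; congr (_ * _).
    by rewrite /block mul0n drop0.
  by apply: eq_bigr => b _; rewrite /block drop_drop -mulSnr.
- exact: seq_measurable_prod_block.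
- by move=> s; apply: prode_ge0.
Qed.

End iid_expectation.

(** * Pointwise divergence and medians *)

Section pointwise_divergence.
Context (R : realType).
Implicit Types p q u v : R.

Lemma ln_le_subr1 (x : R) : 0 < x -> ln x <= x - 1.
Proof.
by move=> x0; have := @le_ln1Dx R (x - 1); rewrite addrCA subrr addr0; apply; lra.
Qed.

(* The integrand of [KL] made nonnegative: it integrates to the same value when
   [p] and [q] have the same mass.  The first branch replaces the junk value of
   [ln (p / 0)]. *)
Definition kl_point p q : \bar R :=
  if (q <= 0) && (0 < p) then +oo%E else (p * ln (p / q) - p + q)%:E.

Lemma kl_point_fin p q : 0 < p -> 0 < q ->
  kl_point p q = (p * ln (p / q) - p + q)%:E.
Proof. by move=> p0 q0; rewrite /kl_point leNgt q0. Qed.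

Lemma kl_point0 q : kl_point 0 q = q%:E.
Proof. by rewrite /kl_point ltxx andbF !mul0r subr0 add0r. Qed.

Lemma kl_pointy p : 0 < p -> kl_point p 0 = +oo%E.
Proof. by rewrite /kl_point lexx => ->. Qed.

(* The convex function [kl_point p] lies above its tangent at [v]. *)
Lemma kl_point_tangent p u v : 0 < p -> 0 < u -> 0 < v ->
  p * ln (p / v) - p + v + (1 - p / v) * (u - v) <= p * ln (p / u) - p + u.
Proof.
move=> p0 u0 v0.
have H : p * ln (u / v) <= p * (u / v - 1).
  by rewrite ler_wpM2l ?(ltW p0)// ln_le_subr1// divr_gt0.
move: H; rewrite !ln_div ?posrE// => H.
rewrite (_ : (1 - p / v) * (u - v) = u - v - p * (u / v - 1)); first by lra.
by field; rewrite gt_eqF.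
Qed.

Lemma kl_point_ge0 p q : 0 <= p -> 0 <= q -> (0 <= kl_point p q)%E.
Proof.
move=> p0 q0; have [->|pp] := eqVneq p 0; first by rewrite kl_point0 lee_fin.
have {pp}p0 : 0 < p by rewrite lt_def pp.
have [->|qq] := eqVneq q 0; first by rewrite kl_pointy.
have {qq}q0 : 0 < q by rewrite lt_def qq.
rewrite kl_point_fin// lee_fin.
have := kl_point_tangent p0 q0 p0.
by rewrite divff ?gt_eqF// ln1 subrr mul0r mulr0; lra.
Qed.

(** Here [v] lies between [p] and [u]. The tangent at [v] has slope [1 - p / v], whose sign is that
    of [v - p], hence agrees with that of [u - v]: moving from [v] to [u] can only increase the
    divergence. *)
Lemma kl_point_quasiconvex p u v : 0 <= p -> 0 <= u -> 0 <= v ->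
  (p <= v) && (v <= u) || (u <= v) && (v <= p) ->
  (kl_point p v <= kl_point p u)%E.
Proof.
move=> p0 u0 v0 H; have [pE|pp] := eqVneq p 0.
  rewrite pE !kl_point0 lee_fin; move: H; rewrite pE.
  by case/orP => /andP[]//; lra.
have {pp}p0 : 0 < p by rewrite lt_def pp.
have [->|uu] := eqVneq u 0; first by rewrite (kl_pointy p0) leey.
have {uu}u0 : 0 < u by rewrite lt_def uu.
have {}v0 : 0 < v by case/orP : H => /andP[]; lra.
rewrite !kl_point_fin// lee_fin.
apply: le_trans (kl_point_tangent p0 u0 v0); rewrite lerDl.
rewrite (_ : _ * _ = v^-1 * ((v - p) * (u - v))); last first.
  by field; rewrite gt_eqF.
apply: mulr_ge0; first by rewrite invr_ge0 ltW.
by case/orP : H => /andP[h1 h2]; [apply: mulr_ge0|apply: mulr_le0]; lra.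
Qed.

(** Jensen's inequality: when the tangent bounds at the mean [v] are summed, the linear terms
    cancel. If some [q t] vanishes while [p > 0], the right-hand side is infinite. *)
Lemma kl_point_convex p N (q : 'I_N.+1 -> R) : 0 <= p -> (forall t, 0 <= q t) ->
  (N.+1%:R%:E * kl_point p (N.+1%:R^-1 * \sum_t q t) <= \sum_t kl_point p (q t))%E.
Proof.
move=> p0 q0; have [->|pp] := eqVneq p 0.
  rewrite kl_point0 -EFinM mulrA divff ?pnatr_eq0// mul1r.
  by under [leRHS]eq_bigr do rewrite kl_point0; rewrite sumEFin.
have {pp}p0 : 0 < p by rewrite lt_def pp.
have [[t qt0]|/forallNP qpos] := pselect (exists t, q t = 0).
  rewrite [leRHS](bigD1 t)//= qt0 (kl_pointy p0) addye ?leey//.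
  rewrite gt_eqF// (lt_le_trans ltNy0)// sume_ge0// => i _.
  exact: kl_point_ge0 (ltW p0) (q0 i).
have {qpos}q0 t : 0 < q t by rewrite lt_def q0 andbT; apply/eqP/qpos.
set v := N.+1%:R^-1 * _.
have Sv : \sum_t q t = N.+1%:R * v by rewrite mulrA divff ?pnatr_eq0// mul1r.
have v0 : 0 < v.
  rewrite mulr_gt0 ?invr_gt0 ?ltr0n// big_ord_recl ltr_wpDr// sumr_ge0// => i _.
  exact/ltW.
under [leRHS]eq_bigr do rewrite kl_point_fin//.
rewrite kl_point_fin// sumEFin -EFinM lee_fin.
have : \sum_(t < N.+1) (p * ln (p / v) - p + v + (1 - p / v) * (q t - v)) <=
       \sum_(t < N.+1) (p * ln (p / q t) - p + q t).
  by apply: ler_sum => t _; exact: kl_point_tangent.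
apply: le_trans.
rewrite big_split/= -mulr_sumr sumrB Sv [\sum_(_ < _) v]sumr_const card_ord.
by rewrite -[v *+ _]mulr_natl subrr mulr0 addr0 sumr_const card_ord mulr_natl.
Qed.

Lemma measurable_fun_inv d (T : measurableType d) (f : T -> R) :
  measurable_fun setT f -> (forall x, 0 <= f x) ->
  measurable_fun setT (fun x => (f x)^-1).
Proof.
move=> mf f0; under eq_fun => x do rewrite -powR_inv1//.
exact: (measurableT_comp (measurable_powR _)).
Qed.

Lemma measurable_kl_point d (T : measurableType d) (f g : T -> R) :
  measurable_fun setT f -> measurable_fun setT g -> (forall x, 0 <= g x) ->
  measurable_fun setT (fun x => kl_point (f x) (g x)).
Proof.
move=> mf mg g0; apply: measurable_fun_ifT => //.
  by apply: measurable_and; [exact: measurable_fun_ler|exact: measurable_fun_ltr].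
apply/measurable_EFinP/measurable_funD => //.
apply: measurable_funB => //; apply: measurable_funM => //.
apply: measurableT_comp; first exact: measurable_ln.
by apply: measurable_funM => //; exact: measurable_fun_inv.
Qed.

End pointwise_divergence.

Section median.
Context (R : realType) (k : nat).
Implicit Types q : 'I_k -> R.

(** The lower median of nonnegative values, as the smallest maximum over a set of at least half of
    the indices. Finite minima and maxima make measurability immediate. For nonnegative values the
    default [\sum_b q b] bounds every such maximum, so it does not affect the minimum. *)
Definition median q : R :=
  \big[Num.min/(\sum_b q b)]_(S : {set 'I_k} | (k <= 2 * #|S|)%N)
    \big[Num.max/0]_(b in S) q b.

Lemma median_attained q : (forall b, 0 <= q b) ->
  exists2 S : {set 'I_k}, (k <= 2 * #|S|)%N & median q = \big[Num.max/0]_(b in S) q b.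
Proof.
move=> q0; have kT : (k <= 2 * #|[set: 'I_k]%SET|)%N by rewrite cardsT card_ord leq_pmull.
rewrite /median; have [|S kS ->] := @eq_bigmin _ _ _ (\sum_b q b) _
    (fun S : {set 'I_k} => (k <= 2 * #|S|)%N)
    (fun S => \big[Num.max/0]_(b in S) q b) kT; last by exists S.
move=> S _; apply: bigmax_le => [|b _]; first by rewrite sumr_ge0.
by rewrite (bigD1 b)//= lerDl sumr_ge0.
Qed.

Lemma median_ge0 q : (forall b, 0 <= q b) -> 0 <= median q.
Proof. by move=> /median_attained[S _ ->]; exact: bigmax_ge_id. Qed.

Lemma median_le_sum q : median q <= \sum_b q b.
Proof. exact: bigmin_le_id. Qed.

Lemma card_le_median q : (forall b, 0 <= q b) ->
  (k <= 2 * #|[set b | (q b <= median q)%R]%SET|)%N.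
Proof.
move=> q0; have [S kS mS] := median_attained q0.
apply: (leq_trans kS); rewrite leq_pmul2l//; apply: subset_leq_card.
by apply/fintype.subsetP => b bS; rewrite inE mS; exact: le_bigmax_cond.
Qed.

(** Otherwise the indices strictly below the median would form at least half of all indices, hence a
    competitor in the minimum with a smaller maximum. *)
Lemma card_ge_median q : (forall b, 0 <= q b) ->
  (k <= 2 * #|[set b | (median q <= q b)%R]%SET|)%N.
Proof.
move=> q0; set S := finset _.
have [kS|] := leqP k (2 * #|~: S|); last first.
  by have := cardsC S; rewrite card_ord; lia.
have [S0|[b bS]] := set_0Vmem (~: S).
  by move: kS; rewrite S0 cards0 muln0 => /leq_trans; apply.
have : median q <= \big[Num.max/0]_(b in ~: S) q b by exact: bigmin_le_cond.
(* The default 0 of the maximum must also be below the median; the index [b] ensures this, as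
   [0 <= q b < median q]. *)
rewrite leNgt => /negP[]; apply/bigmax_ltP; split.
  by move: bS; rewrite !inE -ltNge; exact: le_lt_trans.
by move=> c; rewrite !inE -ltNge.
Qed.

Lemma le_median q c : (0 < k)%N -> (forall b, 0 <= q b) -> (forall b, c <= q b) ->
  c <= median q.
Proof.
move=> k0 q0 cq; have := card_le_median q0; set S := finset _ => kS.
have /card_gt0P[b] : (0 < #|S|)%N by lia.
by rewrite inE; exact: le_trans.
Qed.

(** If [p] is below the median, take the indices above the median, and conversely: the median then
    lies between [p] and [q b], and quasi-convexity applies. *)
Lemma kl_point_median q p : 0 <= p -> (forall b, 0 <= q b) ->
  exists2 S : {set 'I_k}, (k <= 2 * #|S|)%N &
    forall b, b \in S -> (kl_point p (median q) <= kl_point p (q b))%E.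
Proof.
move=> p0 q0; have [pm|mp] := leP p (median q).
  exists [set b | median q <= q b]%SET; first exact: card_ge_median.
  move=> b; rewrite inE => mb; apply: kl_point_quasiconvex => //.
    exact: median_ge0.
  by rewrite pm mb.
exists [set b | q b <= median q]%SET; first exact: card_le_median.
move=> b; rewrite inE => mb; apply: kl_point_quasiconvex => //.
  exact: median_ge0.
by rewrite mb (ltW mp) orbT.
Qed.

(* At least half of the indices satisfy the bound of [kl_point_median], hence at
   least [k/2 - #|~: G|] of those in [G]. *)
Lemma kl_point_median_sum q p (G : {set 'I_k}) : 0 <= p -> (forall b, 0 <= q b) ->
  ((k - 2 * #|~: G|)%:R%:E * kl_point p (median q) <=
     2%:E * \sum_(b in G) kl_point p (q b))%E.
Proof.
move=> p0 q0; have [S kS HS] := kl_point_median p0 q0.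
have D0 : (0 <= kl_point p (median q))%E by apply: kl_point_ge0 => //; exact: median_ge0.
apply: (@le_trans _ _ ((2 * #|S :&: G|)%:R%:E * kl_point p (median q))%E).
  apply: lee_wpmul2r => //; rewrite lee_fin ler_nat.
  have := cardsID G S; have : (#|S :\: G| <= #|~: G|)%N.
    by apply: subset_leq_card; apply/fintype.subsetP => x; rewrite !inE => /andP[].
  by lia.
rewrite natrM EFinM -muleA; apply: lee_wpmul2l; first by rewrite lee_fin.
apply: (@le_trans _ _ (\sum_(b in S :&: G) kl_point p (q b))%E).
  rewrite -sumr_const -sumEFin ge0_sume_distrl => [|b _]; last by rewrite lee_fin.
  apply: lee_sum => b; rewrite mul1e.
  by rewrite inE => /andP[bS _]; exact: HS.
rewrite [leRHS](big_setID S)/= finset.setIC leeDl// sume_ge0// => b _.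
exact: kl_point_ge0.
Qed.

Lemma measurable_median d (T : measurableType d) (q : 'I_k -> T -> R) :
  (forall b, measurable_fun setT (q b)) ->
  measurable_fun setT (fun x => median (q ^~ x)).
Proof.
move=> mq; rewrite /median.
have mmax (S : {set 'I_k}) (r : seq 'I_k) :
    measurable_fun setT (fun x => \big[Num.max/0]_(b <- r | b \in S) q b x).
  elim: r => [|b r IHr].
    by under eq_fun do rewrite big_nil; exact: measurable_cst.
  case bS : (b \in S); under eq_fun do rewrite big_cons bS; last exact: IHr.
  exact: measurable_maxr.
have mmin (r : seq {set 'I_k}) : measurable_fun setT
    (fun x => \big[Num.min/(\sum_b q b x)]_(S <- r | (k <= 2 * #|S|)%N)
                \big[Num.max/0]_(b in S) q b x).
  elim: r => [|S r IHr].
    by under eq_fun do rewrite big_nil; exact: measurable_sum.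
  case kS : (k <= 2 * #|S|)%N; under eq_fun do rewrite big_cons kS; last exact: IHr.
  by apply: measurable_minr => //; exact: mmax.
exact: mmin.
Qed.

End median.

(** * From the pointwise divergence to the Kullback-Leibler divergence *)

Section KL_kl_point.
Context d (T : measurableType d) (R : realType) (mu : {measure set T -> \bar R}).
Local Open Scope ereal_scope.

Lemma ge0_integrable_EFin (f : T -> R) : measurable_fun setT f ->
  (forall x, 0 <= f x)%R -> \int[mu]_x (f x)%:E < +oo ->
  mu.-integrable setT (EFin \o f).
Proof.
move=> mf f0 fy; apply/integrableP; split; first exact/measurable_EFinP.
by under eq_integral do rewrite gee0_abs ?lee_fin//.
Qed.

(** Normalizing never hurts: when the right-hand side is finite, the two sides differ by
    [1 + ln Z - Z], which is at most 0. The domination of [c * p] by [q] yields [0 < Z], absolute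
    continuity, and [p = 0] wherever [q = 0]. *)
Lemma KL_normalized_le (p q : T -> R) (c Z : R) : is_density mu p ->
  measurable_fun setT q -> (forall x, 0 <= q x)%R ->
  (0 < c)%R -> (forall x, c * p x <= q x)%R -> \int[mu]_x (q x)%:E = Z%:E ->
  KL mu p (fun x => q x / Z)%R <= \int[mu]_x kl_point (p x) (q x).
Proof.
move=> [mp p0 ip] mq q0 c0 cpq iq.
have Z0 : (0 < Z)%R.
  rewrite -lte_fin -iq (@lt_le_trans _ _ c%:E) ?lte_fin//.
  rewrite -[c%:E]mule1 -ip -ge0_integralZl ?lee_fin ?(ltW c0)//; last 2 first.
    exact/measurable_EFinP.
    by move=> x _; rewrite lee_fin.
  apply: ge0_le_integral => //.
  - by move=> x _; rewrite -EFinM lee_fin mulr_ge0// ltW.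
  - by apply/measurable_EFinP; exact: measurable_funM.
  - exact/measurable_EFinP.
  - by move=> x _; rewrite -EFinM lee_fin.
have qp0 x : (q x <= 0 -> p x = 0)%R.
  move=> qx; apply/eqP; rewrite eq_le p0 andbT -(pmulr_rle0 _ c0).
  exact: le_trans (cpq x) qx.
have Dge0 x : 0 <= kl_point (p x) (q x) by exact: kl_point_ge0.
have [->|] := eqVneq (\int[mu]_x kl_point (p x) (q x)) +oo; first exact: leey.
rewrite -ltey => Dy.
pose D x := (p x * ln (p x / q x) - p x + q x)%R.
have DE x : kl_point (p x) (q x) = (D x)%:E.
  by rewrite /kl_point; case: ifP => // /andP[/qp0 ->]; rewrite ltxx.
have mD : measurable_fun setT D.
  apply/measurable_EFinP; rewrite (_ : _ \o _ = fun x => kl_point (p x) (q x)).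
    exact: measurable_kl_point.
  by apply/funext => x /=; rewrite DE.
have D0 x : (0 <= D x)%R by rewrite -lee_fin -DE.
have iD : mu.-integrable setT (EFin \o D).
  by apply: ge0_integrable_EFin => //; under eq_integral do rewrite -DE.
have ipI : mu.-integrable setT (EFin \o p).
  by apply: ge0_integrable_EFin => //; rewrite ip ltry.
have iqI : mu.-integrable setT (EFin \o q).
  by apply: ge0_integrable_EFin => //; rewrite iq ltry.
rewrite /KL; case: asboolP => [_|]; last first.
  case => A NA B mB BA; have := NA _ mB BA.
  rewrite /density_law => qB; apply/eqP; rewrite eq_le.
  rewrite integral_ge0 ?andbT => [|x _]; last by rewrite lee_fin.
  rewrite (@le_trans _ _ (\int[mu]_(x in B) ((Z / c)%:E * (q x / Z)%:E)))//.
    apply: ge0_le_integral => //.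
    - by move=> x _; rewrite lee_fin.
    - by apply/measurable_EFinP; exact: measurable_funTS.
    - apply/measurable_EFinP; apply: measurable_funTS; apply: measurable_funM => //.
      exact: measurable_funM.
    - move=> x _; rewrite -EFinM lee_fin (_ : Z / c * (q x / Z) = q x / c)%R.
        by rewrite ler_pdivlMr// mulrC.
      by field; rewrite !gt_eqF.
  rewrite ge0_integralZl ?qB ?mule0//.
  - by apply/measurable_EFinP; apply: measurable_funTS; exact: measurable_funM.
  - by move=> x _; rewrite lee_fin divr_ge0// ltW.
  - by rewrite lee_fin divr_ge0// ltW.
have fE x : (p x * ln (p x / (q x / Z)) = D x + ((1 + ln Z) * p x - q x))%R.
  have [px|px] := eqVneq (p x) 0%R.
    by rewrite /D px !mul0r; lra.
  have {}px : (0 < p x)%R by rewrite lt_def px p0.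
  have qx : (0 < q x)%R by apply: lt_le_trans (cpq x); rewrite mulr_gt0.
  have -> : (ln (p x / (q x / Z)) = ln (p x / q x) + ln Z)%R.
    rewrite -lnM ?posrE ?divr_gt0//; congr ln.
    by field; rewrite !gt_eqF.
  by rewrite /D; ring.
under eq_integral => x _.
  rewrite (_ : _%:E = (D x)%:E + ((1 + ln Z)%:E * (p x)%:E - (q x)%:E)); last first.
    by rewrite fE -EFinM -EFinB -EFinD.
  over.
have icp : mu.-integrable setT (fun x => (1 + ln Z)%:E * (p x)%:E).
  exact: integrableZl.
rewrite (integralD _ iD (integrableB _ icp iqI))// (integralB _ icp iqI)//.
rewrite integralZl// ip mule1 iq.
under [leRHS]eq_integral do rewrite DE.
rewrite -[leRHS]adde0; apply: leeD2l.
rewrite -EFinB lee_fin.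
by have := ln_le_subr1 Z0; lra.
Qed.

End KL_kl_point.

(** * Bayes mixtures *)

Section bayes.
Context d (T : measurableType d) (R : realType) (mu : {measure set T -> \bar R}).
Variables (M : nat) (p : 'I_M -> T -> R).
Hypothesis dp : forall i, is_density mu (p i).

Let mp i : measurable_fun setT (p i). Proof. by case: (dp i). Qed.
Let p0 i x : 0 <= p i x. Proof. by case: (dp i) => _ + _; exact. Qed.
Let mpE i : measurable_fun setT (fun x => (p i x)%:E).
Proof. exact/measurable_EFinP. Qed.

Definition likelihood i (s : seq T) : R := \prod_(x <- s) p i x.

Definition evidence s : R := \sum_i likelihood i s.

(* If the evidence vanishes this is 0 and not a density; this is harmless, since
   then the likelihood of the true density vanishes too, a null event. *)
Definition bayes s y : R := (\sum_i likelihood i s * p i y) / evidence s.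

Lemma likelihood_ge0 i s : 0 <= likelihood i s.
Proof. exact: prodr_ge0. Qed.

Lemma likelihood_nil i : likelihood i [::] = 1.
Proof. exact: big_nil. Qed.

Lemma likelihood_rcons i s x : likelihood i (rcons s x) = likelihood i s * p i x.
Proof. by rewrite /likelihood -cats1 big_cat big_seq1. Qed.

Lemma evidence_ge0 s : 0 <= evidence s.
Proof. by apply: sumr_ge0 => i _; exact: likelihood_ge0. Qed.

Lemma evidence_nil : evidence [::] = M%:R.
Proof.
by rewrite /evidence; under eq_bigr do rewrite likelihood_nil;
   rewrite sumr_const card_ord.
Qed.

Lemma le_likelihood_evidence i s : likelihood i s <= evidence s.
Proof.
rewrite /evidence (bigD1 i)//= lerDl; apply: sumr_ge0 => l _.
exact: likelihood_ge0.
Qed.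

Lemma bayes_ge0 s y : 0 <= bayes s y.
Proof.
rewrite divr_ge0 ?evidence_ge0//; apply: sumr_ge0 => i _.
by rewrite mulr_ge0// likelihood_ge0.
Qed.

Lemma measurable_bayes s : measurable_fun setT (bayes s).
Proof.
apply: measurable_funM => //; apply: measurable_sum => i.
exact: measurable_funM.
Qed.

Lemma integral_bayes s : 0 < evidence s -> (\int[mu]_y (bayes s y)%:E = 1)%E.
Proof.
move=> s0; rewrite /bayes.
under eq_integral do rewrite mulrC EFinM -sumEFin.
rewrite ge0_integralZl//; last 3 first.
- by apply: emeasurable_sum => i; apply/measurable_EFinP/measurable_funM.
- by move=> x _; apply: sume_ge0 => i _; rewrite lee_fin mulr_ge0// likelihood_ge0.
- by rewrite lee_fin invr_ge0 ltW.
rewrite ge0_integral_sum//; last 2 first.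
- by move=> i; apply/measurable_EFinP/measurable_funM.
- by move=> i x _; rewrite lee_fin mulr_ge0// likelihood_ge0.
under eq_bigr => i _.
  under eq_integral do rewrite EFinM.
  rewrite ge0_integralZl//; last 2 first.
  - by move=> x _; rewrite lee_fin.
  - by rewrite lee_fin likelihood_ge0.
  case: (dp i) => _ _ ->; rewrite mule1; over.
by rewrite sumEFin -EFinM mulVf ?gt_eqF.
Qed.

Lemma bayes_ge s i y : likelihood i s / evidence s * p i y <= bayes s y.
Proof.
rewrite mulrAC ler_wpM2r ?invr_ge0 ?evidence_ge0//.
rewrite (bigD1 i)//= lerDl; apply: sumr_ge0 => l _.
by rewrite mulr_ge0// likelihood_ge0.
Qed.

Lemma bayes_nil_ge i y : M%:R^-1 * p i y <= bayes [::] y.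
Proof. by have := bayes_ge [::] i y; rewrite likelihood_nil evidence_nil mul1r. Qed.

Section posterior.
Variable j : 'I_M.

Let nu := density_probability (dp j).

(* Minus the logarithm of the posterior weight of [p j] under the uniform prior.
   The value +oo makes [bayes_risk_step] hold for samples of zero likelihood. *)
Definition log_posterior s : \bar R :=
  if 0 < likelihood j s then (ln (evidence s / likelihood j s))%:E else +oo%E.

Definition bayes_risk s : \bar R :=
  (\int[mu]_y kl_point (p j y) (bayes s y))%E.

Lemma log_posterior_ge0 s : (0 <= log_posterior s)%E.
Proof.
rewrite /log_posterior; case: ifPn => // s0; rewrite lee_fin ln_ge0//.
by rewrite ler_pdivlMr// mul1r le_likelihood_evidence.
Qed.

Lemma bayes_risk_ge0 s : (0 <= bayes_risk s)%E.
Proof.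
by apply: integral_ge0 => y _; apply: kl_point_ge0 => //; exact: bayes_ge0.
Qed.

Lemma log_posterior_nil : log_posterior [::] = (ln M%:R)%:E.
Proof. by rewrite /log_posterior likelihood_nil ltr01 divr1 evidence_nil. Qed.

Lemma measurable_log_posterior_rcons s :
  measurable_fun setT (fun y => log_posterior (rcons s y)).
Proof.
apply: measurable_fun_ifT => //.
  apply: measurable_fun_ltr => //.
  by under eq_fun do rewrite likelihood_rcons; exact: measurable_funM.
apply/measurable_EFinP/measurableT_comp; first exact: measurable_ln.
apply: measurable_funM.
  apply: measurable_sum => i.
  by under eq_fun do rewrite likelihood_rcons; exact: measurable_funM.
apply: measurable_fun_inv => [|x]; last exact: likelihood_ge0.
by under eq_fun do rewrite likelihood_rcons; exact: measurable_funM.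
Qed.

(** Observing [y] changes [log_posterior] by [ln (bayes s y / p j y)], which cancels the logarithm
    in the divergence. What remains is linear in the two densities, both of mass 1. For a sample of
    zero likelihood the right-hand side is infinite. *)
Lemma bayes_risk_step s :
  (bayes_risk s + \int[nu]_y log_posterior (rcons s y) <= log_posterior s)%E.
Proof.
rewrite integral_density_probability//; last 2 first.
- exact: measurable_log_posterior_rcons.
- by move=> x; exact: log_posterior_ge0.
rewrite {2}/log_posterior; case: ifPn => [s0|_]; last exact: leey.
have e0 : 0 < evidence s by apply: lt_le_trans s0 _; exact: le_likelihood_evidence.
set l := ln _.
have l0 : 0 <= l by rewrite ln_ge0// ler_pdivlMr// mul1r le_likelihood_evidence.
have step y : (kl_point (p j y) (bayes s y) +
    (p j y)%:E * log_posterior (rcons s y) + (p j y)%:E =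
    (bayes s y)%:E + (l * p j y)%:E)%E.
  have [->|pn0] := eqVneq (p j y) 0.
    by rewrite kl_point0 mul0e mulr0 adde0.
  have pp : 0 < p j y by rewrite lt_def pn0 p0.
  have bp : 0 < bayes s y.
    by apply: lt_le_trans (bayes_ge s j y); rewrite mulr_gt0 ?divr_gt0.
  (* The predictive density is the ratio of successive evidences. *)
  have er : evidence (rcons s y) = bayes s y * evidence s.
    rewrite /bayes divfK ?gt_eqF//; apply: eq_bigr => i _.
    by rewrite likelihood_rcons.
  rewrite kl_point_fin// /log_posterior likelihood_rcons mulr_gt0// er.
  rewrite -!EFinM -!EFinD; congr (_%:E).
  rewrite (_ : bayes s y * _ / _ =
    (bayes s y / p j y) * (evidence s / likelihood j s)); last first.
    by field; rewrite !gt_eqF.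
  have -> : ln (p j y / bayes s y) = - ln (bayes s y / p j y).
    rewrite -lnV; last by rewrite posrE divr_gt0.
    by congr ln; field; rewrite !gt_eqF.
  rewrite [ln (bayes s y / _ * _)]lnM; try by rewrite posrE divr_gt0.
  rewrite -/l.
  by ring.
have mkl : measurable_fun setT (fun y => kl_point (p j y) (bayes s y)).
  by apply: measurable_kl_point => //; [exact: measurable_bayes|exact: bayes_ge0].
have kl0 y : (0 <= kl_point (p j y) (bayes s y))%E.
  by apply: kl_point_ge0 => //; exact: bayes_ge0.
have mlp : measurable_fun setT (fun y => (p j y)%:E * log_posterior (rcons s y))%E.
  by apply: emeasurable_funM => //; exact: measurable_log_posterior_rcons.
have lp0 y : (0 <= (p j y)%:E * log_posterior (rcons s y))%E.
  by rewrite mule_ge0 ?lee_fin// log_posterior_ge0.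
have ij : (\int[mu]_y (p j y)%:E = 1)%E by case: (dp j).
(* Adding the mass of [p j] to both sides keeps all terms nonnegative, so that the integrals can be
   added without integrability conditions. *)
suff : (bayes_risk s + \int[mu]_y ((p j y)%:E * log_posterior (rcons s y)) +
    \int[mu]_y (p j y)%:E <= l%:E + 1)%E by rewrite ij leeD2rE.
rewrite /bayes_risk -ge0_integralD// -ge0_integralD//; last 3 first.
- by move=> y _; rewrite adde_ge0.
- exact: emeasurable_funD.
- by move=> y _; rewrite lee_fin.
under eq_integral do rewrite step.
rewrite ge0_integralD//; last 4 first.
- by move=> y _; rewrite lee_fin bayes_ge0.
- by apply/measurable_EFinP; exact: measurable_bayes.
- by move=> y _; rewrite lee_fin mulr_ge0.
- by apply/measurable_EFinP; exact: measurable_funM.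
rewrite integral_bayes//.
under eq_integral do rewrite EFinM.
rewrite ge0_integralZl//; last by move=> y _; rewrite lee_fin.
by rewrite ij mule1 addeC.
Qed.

End posterior.
End bayes.

Section bayes_average.
Context d (T : measurableType d) (R : realType) (mu : {measure set T -> \bar R}).
Variables (M : nat) (p : 'I_M -> T -> R).
Hypothesis dp : forall i, is_density mu (p i).

Let mp i : measurable_fun setT (p i). Proof. by case: (dp i). Qed.
Let p0 i x : 0 <= p i x. Proof. by case: (dp i) => _ + _; exact. Qed.

Lemma seq_measurable_likelihood i : seq_measurable (likelihood p i).
Proof.
move=> n; rewrite /likelihood; under eq_fun do rewrite big_tuple.
apply: measurable_prod => k _.
exact: (measurableT_comp (mp i) (measurable_tnth k)).
Qed.

Lemma seq_measurable_evidence : seq_measurable (evidence p).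
Proof. by move=> n; apply: measurable_sum => i; exact: seq_measurable_likelihood. Qed.

Lemma measurable_bayes_pair n :
  measurable_fun setT (fun z : n.-tuple T * T => bayes p z.1 z.2).
Proof.
apply: measurable_funM.
  apply: measurable_sum => i; apply: measurable_funM.
    exact: measurableT_comp (@seq_measurable_likelihood i n) measurable_fst.
  exact: measurableT_comp.
apply: measurable_fun_inv => [|z]; last exact: evidence_ge0 dp _.
exact: measurableT_comp (@seq_measurable_evidence n) measurable_fst.
Qed.

(* [mu] need not be sigma-finite, so Tonelli's theorem is applied to the law with
   density [bayes p [::]], the uniform mixture, which dominates all the [p i]. *)
Lemma seq_measurable_bayes_risk j : seq_measurable (bayes_risk mu p j).
Proof.
have M0 : (0 < M)%N by exact: leq_ltn_trans (ltn_ord j).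
pose u := bayes p [::].
have u0 y : 0 <= u y by exact: bayes_ge0 dp _ _.
have mu_ : measurable_fun setT u by exact: measurable_bayes dp _.
have du : is_density mu u.
  by split => //; apply: integral_bayes dp _ _; rewrite evidence_nil ltr0n.
move=> n.
pose g (z : n.-tuple T * T) : \bar R :=
  ((u z.2)^-1%:E * kl_point (p j z.2) (bayes p z.1 z.2))%E.
have mg : measurable_fun setT g.
  apply: emeasurable_funM.
    apply/measurable_EFinP/measurable_fun_inv => //.
    exact: measurableT_comp mu_ measurable_snd.
  apply: measurable_kl_point => [||z]; last exact: bayes_ge0 dp _ _.
    exact: measurableT_comp.
  exact: measurable_bayes_pair.
have g0 z : (0 <= g z)%E.
  rewrite mule_ge0 ?lee_fin ?invr_ge0//; apply: kl_point_ge0 => //.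
  exact: bayes_ge0 dp _ _.
rewrite (_ : (fun t : n.-tuple T => _) =
    fubini_F (density_probability du) g); last first.
  apply/funext => t; rewrite /fubini_F integral_density_probability//.
    apply: eq_integral => y _; rewrite /g/= muleA -EFinM.
    (* Where the uniform mixture vanishes, so do all the [p i] and hence [bayes]; the divergence
       there is 0. *)
    have [uy|uy] := eqVneq (u y) 0; last by rewrite divff// mul1e.
    have pi0 i : p i y = 0.
      apply/eqP; rewrite eq_le p0 andbT -(@pmulr_rle0 _ M%:R^-1) ?invr_gt0 ?ltr0n//.
      by rewrite -uy; exact: bayes_nil_ge dp _ _.
    rewrite pi0 kl_point0 /bayes; under eq_bigr do rewrite pi0 mulr0.
    by rewrite big1// mul0r mule0.
  exact: measurableT_comp mg (pair1_measurable _).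
exact: measurable_fun_fubini_tonelli_F.
Qed.

Definition bayes_avg m (s : seq T) (y : T) : R :=
  m.+1%:R^-1 * \sum_(t < m.+1) bayes p (take t s) y.

Lemma bayes_avg_ge0 m s y : 0 <= bayes_avg m s y.
Proof.
rewrite mulr_ge0 ?invr_ge0//; apply: sumr_ge0 => t _; exact: bayes_ge0 dp _ _.
Qed.

Lemma measurable_bayes_avg m s : measurable_fun setT (bayes_avg m s).
Proof.
by apply: measurable_funM => //; apply: measurable_sum => t; exact: measurable_bayes dp _.
Qed.

(** The term [t = 0] is the uniform mixture, so it alone gives this domination, for every sample
    [s]. *)
Lemma bayes_avg_ge m s i y : (m.+1%:R * M%:R)^-1 * p i y <= bayes_avg m s y.
Proof.
rewrite invfM -mulrA ler_wpM2l ?invr_ge0// big_ord_recl take0.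
apply: le_trans (bayes_nil_ge dp _ _) _.
by rewrite lerDl; apply: sumr_ge0 => t _; exact: bayes_ge0 dp _ _.
Qed.

Lemma integral_bayes_avg_lty m s : (\int[mu]_y (bayes_avg m s y)%:E < +oo)%E.
Proof.
(* Only an inequality: the mixture is 0 when the evidence vanishes. *)
have ib t : (\int[mu]_y (bayes p (take t s) y)%:E <= 1)%E.
  have [e0|e0] := ltP 0 (evidence p (take t s)).
    by rewrite (integral_bayes dp).
  rewrite /bayes; have /eqP -> : evidence p (take t s) == 0.
    by rewrite eq_le e0 (evidence_ge0 dp).
  by under eq_integral do rewrite invr0 mulr0; rewrite integral0.
rewrite /bayes_avg; under eq_integral do rewrite EFinM -sumEFin.
rewrite ge0_integralZl//; last 2 first.
- apply: emeasurable_sum => t; apply/measurable_EFinP; exact: measurable_bayes dp _.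
- by move=> x _; apply: sume_ge0 => t _; rewrite lee_fin; exact: bayes_ge0 dp _ _.
rewrite ge0_integral_sum//; last 2 first.
- by move=> t; apply/measurable_EFinP; exact: measurable_bayes dp _.
- by move=> t x _; rewrite lee_fin; exact: bayes_ge0 dp _ _.
rewrite lte_mul_pinfty ?lee_fin ?invr_ge0//.
apply/lte_sum_pinfty => t _; exact: le_lt_trans (ib t) (ltry _).
Qed.

Section risk.
Variable j : 'I_M.
Let nu := density_probability (dp j).

(** The telescoping, with an arbitrary past [u] for the induction: isolate the risk at [u], apply
    the induction hypothesis to [u] extended by the first new observation, then use
    [bayes_risk_step]. *)
Lemma iidE_bayes_risk m u :
  (iidE nu m (fun s => \sum_(t < m.+1) bayes_risk mu p j (u ++ take t s)) <=
   log_posterior p j u)%E.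
Proof.
have mrisk v k : seq_measurable
    (fun s => \sum_(t < k) bayes_risk mu p j (v ++ take t s))%E.
  move=> n; apply: emeasurable_sum => t.
  apply: (seq_measurable_take (F := fun s => bayes_risk mu p j (v ++ s))).
  exact: seq_measurable_cat (seq_measurable_bayes_risk _).
have risk0 v k s : (0 <= \sum_(t < k) bayes_risk mu p j (v ++ take t s))%E.
  by apply: sume_ge0 => t _; exact: bayes_risk_ge0.
elim: m u => [|m IHm] u.
  rewrite iidE0// big_ord1 cats0; apply: le_trans (bayes_risk_step dp _ _).
  by rewrite leeDl// integral_ge0// => y _; exact: log_posterior_ge0.
rewrite iidES//; apply: le_trans (bayes_risk_step dp _ _).
apply: (@le_trans _ _
  (\int[nu]_x (bayes_risk mu p j u + log_posterior p j (rcons u x)))%E); last first.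
  rewrite ge0_integralD//.
  - by rewrite integral_cst// [X in (_ * X)%E]probability_setT mule1.
  - by move=> x _; exact: bayes_risk_ge0.
  - by move=> x _; exact: log_posterior_ge0.
  - exact: measurable_log_posterior_rcons.
apply: ge0_le_integral => //.
- by move=> x _; exact: iidE_ge0.
- exact: (@measurable_iidE_cons _ _ _ nu m _ (mrisk u m.+2) (risk0 u m.+2)).
- by apply: emeasurable_funD => //; exact: measurable_log_posterior_rcons.
move=> x _; rewrite /iidE.
under eq_integral => t _.
  rewrite big_ord_recl take0 cats0.
  under eq_bigr do rewrite /= add0n -cat_rcons.
  over.
rewrite ge0_integralD//; last 2 first.
- by move=> t _; exact: bayes_risk_ge0.
- exact: mrisk.
rewrite integral_cst// [X in (_ * X)%E]probability_setT mule1.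
by apply: leeD2l; exact: IHm.
Qed.

Definition bayes_avg_risk m (s : seq T) : \bar R :=
  (m.+1%:R^-1%:E * \sum_(t < m.+1) bayes_risk mu p j (take t s))%E.

Lemma bayes_avg_risk_ge0 m s : (0 <= bayes_avg_risk m s)%E.
Proof.
rewrite mule_ge0 ?lee_fin ?invr_ge0//; apply: sume_ge0 => t _.
exact: bayes_risk_ge0.
Qed.

Lemma seq_measurable_bayes_avg_risk m : seq_measurable (bayes_avg_risk m).
Proof.
move=> n; apply: emeasurable_funM => //; apply: emeasurable_sum => t.
exact: (seq_measurable_take _ (seq_measurable_bayes_risk j)).
Qed.

Lemma iidE_bayes_avg_risk m :
  (iidE nu m (bayes_avg_risk m) <= (ln M%:R / m.+1%:R)%:E)%E.
Proof.
rewrite iidEZl//; last 2 first.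
- move=> n; apply: emeasurable_sum => t.
  exact: (seq_measurable_take _ (seq_measurable_bayes_risk j)).
- by move=> s; apply: sume_ge0 => t _; exact: bayes_risk_ge0.
have := iidE_bayes_risk m [::]; rewrite (log_posterior_nil p j) => le_m.
rewrite (mulrC (ln _)) EFinM.
by apply: lee_wpmul2l; first by rewrite lee_fin invr_ge0.
Qed.

Lemma kl_point_bayes_avg_le m s :
  (\int[mu]_y kl_point (p j y) (bayes_avg m s y) <= bayes_avg_risk m s)%E.
Proof.
have mkl t : measurable_fun setT (fun y => kl_point (p j y) (bayes p (take t s) y)).
  apply: measurable_kl_point => //; first exact: measurable_bayes dp _.
  by move=> y; exact: bayes_ge0 dp _ _.
have kl0 t y : (0 <= kl_point (p j y) (bayes p (take t s) y))%E.
  by apply: kl_point_ge0 => //; exact: bayes_ge0 dp _ _.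
rewrite /bayes_avg_risk -ge0_integral_sum// -ge0_integralZl//; last 2 first.
- exact: emeasurable_sum.
- by move=> y _; exact: sume_ge0.
apply: ge0_le_integral => //.
- by move=> y _; apply: kl_point_ge0 => //; exact: bayes_avg_ge0.
- apply: measurable_kl_point => //; first exact: measurable_bayes_avg.
  exact: bayes_avg_ge0.
- by apply: emeasurable_funM => //; exact: emeasurable_sum.
move=> y _; rewrite muleC lee_pdivlMr ?ltr0n// muleC.
by apply: kl_point_convex => // t; exact: bayes_ge0 dp _ _.
Qed.

End risk.
End bayes_average.

(** * Aggregation by medians *)

Section truncated_risk.
Context (R : realType).
Implicit Types (rho : R) (e : \bar R).

(* [min(e / rho, 1)] as a real number, including for [e = +oo]. *)
Definition truncated rho e : R := fine (mine (rho^-1%:E * e) 1)%E.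

Lemma truncatedE rho e : 0 < rho -> (0 <= e)%E ->
  (truncated rho e)%:E = mine (rho^-1%:E * e)%E 1%E.
Proof.
move=> r0 e0; rewrite fineK// ge0_fin_numE.
  by rewrite gt_min ltry orbT.
by rewrite le_min lee01 andbT mule_ge0// lee_fin invr_ge0 ltW.
Qed.

Lemma truncated_ge0 rho e : 0 < rho -> (0 <= e)%E -> 0 <= truncated rho e.
Proof.
move=> r0 e0; rewrite -lee_fin truncatedE// le_min lee01 andbT.
by rewrite mule_ge0// lee_fin invr_ge0 ltW.
Qed.

Lemma truncated_le1 rho e : 0 < rho -> (0 <= e)%E -> truncated rho e <= 1.
Proof. by move=> r0 e0; rewrite -lee_fin truncatedE// ge_min lexx orbT. Qed.

Lemma truncated_le rho e : 0 < rho -> (0 <= e)%E ->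
  ((truncated rho e)%:E <= rho^-1%:E * e)%E.
Proof. by move=> r0 e0; rewrite truncatedE// ge_min lexx. Qed.

Lemma truncated_lt1 rho e : 0 < rho -> (0 <= e)%E -> truncated rho e < 1 ->
  e = (rho * truncated rho e)%:E.
Proof.
move=> r0 e0; rewrite -lte_fin => t1; rewrite EFinM; move: t1.
rewrite truncatedE// gt_min ltxx orbF => t1; rewrite min_l ?(ltW t1)//.
by rewrite muleA -EFinM divff ?gt_eqF// mul1e.
Qed.

End truncated_risk.

Section integral_median.
Context d (T : measurableType d) (R : realType) (mu : {measure set T -> \bar R}).

(** One sum controls both the number of bad blocks, each counting 1, and the risks of the good ones.
    With [N] equal to [k] minus twice the number of bad blocks, [kl_point_median_sum] bounds [N]
    times the integral by twice the good risks, that is by less than [N * rho]. *)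
Lemma integral_kl_point_median k (p : T -> R) (q : 'I_k -> T -> R)
    (e : 'I_k -> \bar R) (rho : R) :
  measurable_fun setT p -> (forall x, 0 <= p x) ->
  (forall b, measurable_fun setT (q b)) -> (forall b x, 0 <= q b x) ->
  (forall b, \int[mu]_x kl_point (p x) (q b x) <= e b)%E ->
  0 < rho -> 2 * \sum_b truncated rho (e b) < k%:R ->
  (\int[mu]_x kl_point (p x) (median (q ^~ x)) <= rho%:E)%E.
Proof.
move=> mp p0 mq q0 qe r0 le_k.
have mkl b : measurable_fun setT (fun x => kl_point (p x) (q b x)).
  exact: measurable_kl_point.
have kl0 b x : (0 <= kl_point (p x) (q b x))%E by exact: kl_point_ge0.
have e0 b : (0 <= e b)%E.
  by apply: le_trans (qe b); apply: integral_ge0 => x _.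
pose G : {set 'I_k} := [set b | truncated rho (e b) < 1]%SET.
have zG : \sum_b truncated rho (e b) = \sum_(b in G) truncated rho (e b) + #|~: G|%:R.
  rewrite (bigID (mem G))/=; congr (_ + _).
  rewrite (eq_bigr (fun=> 1)) => [|b].
    by rewrite sumr_const; congr (_ *+ _); apply: eq_card => b; rewrite finset.in_setC.
  rewrite inE -leNgt => t1; apply/eqP.
  by rewrite eq_le t1 truncated_le1.
have SG0 : 0 <= \sum_(b in G) truncated rho (e b).
  by apply: sumr_ge0 => b _; exact: truncated_ge0.
have badk : (2 * #|~: G| < k)%N.
  by rewrite -(ltr_nat R) natrM; move: le_k; rewrite zG; lra.
set N := (k - 2 * #|~: G|)%N.
have N0 : (0 < N)%N by rewrite subn_gt0.
have NE : N%:R = k%:R - 2 * #|~: G|%:R :> R by rewrite natrB ?(ltnW badk)// natrM.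
have mmed : measurable_fun setT (fun x => median (q ^~ x)).
  exact: measurable_median.
have med0 x : (0 <= kl_point (p x) (median (q ^~ x)))%E.
  by apply: kl_point_ge0 => //; exact: median_ge0.
have mklm : measurable_fun setT (fun x => kl_point (p x) (median (q ^~ x))).
  by apply: measurable_kl_point => // x; exact: median_ge0.
rewrite -(@lee_pmul2l _ N%:R%:E)//; last by rewrite lte_fin ltr0n.
rewrite -ge0_integralZl//.
apply: (@le_trans _ _
  (\int[mu]_x (2%:E * \sum_(b <- enum G) kl_point (p x) (q b x)))%E).
  apply: ge0_le_integral => //.
  - by move=> x _; rewrite mule_ge0// lee_fin.
  - exact: emeasurable_funM.
  - by apply: emeasurable_funM => //; exact: emeasurable_sum.
  - move=> x _; rewrite big_enum.
    exact: (kl_point_median_sum G (p0 x) (q0 ^~ x)).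
rewrite ge0_integralZl//; last 2 first.
- exact: emeasurable_sum.
- by move=> x _; exact: sume_ge0.
rewrite ge0_integral_sum// big_enum.
apply: (@le_trans _ _ (2%:E * \sum_(b in G) (rho * truncated rho (e b))%:E)%E).
  apply: lee_wpmul2l; first by rewrite lee_fin.
  apply: lee_sum => b; rewrite inE => /truncated_lt1 <-//.
rewrite sumEFin -EFinM -EFinM lee_fin -mulr_sumr NE.
move: le_k; rewrite zG => le_k.
rewrite mulrCA [leRHS]mulrC ler_pM2l//; lra.
Qed.

End integral_median.

(** * Concentration over independent blocks *)

Section concentration.
Context d (T : measurableType d) (R : realType) (nu : probability T R).

(** The tangent to [expR] at [z * c] lies below the curve at 0 and at [c]; average these two bounds
    with weights [1 - z] and [z]. *)
Lemma expR_convex (c z : R) : 0 <= z -> z <= 1 ->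
  expR (z * c) <= 1 + z * (expR c - 1).
Proof.
move=> z0 z1; have e0 := expR_ge0 (z * c).
have H0 : expR (z * c) * (1 - z * c) <= 1.
  have := ler_wpM2l e0 (expR_ge1Dx (- (z * c))).
  by rewrite -expRD subrr expR0.
have H1 : expR (z * c) * (1 + (c - z * c)) <= expR c.
  have := ler_wpM2l e0 (expR_ge1Dx (c - z * c)).
  by rewrite -expRD (_ : z * c + (c - z * c) = c)//; ring.
have z1' : 0 <= 1 - z by lra.
have := lerD (ler_wpM2l z1' H0) (ler_wpM2l z0 H1).
have -> : (1 - z) * (expR (z * c) * (1 - z * c)) +
  z * (expR (z * c) * (1 + (c - z * c))) = expR (z * c) by ring.
by lra.
Qed.

(* [16 ^ z <= 1 + 15 z] on [0, 1], by convexity. *)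
Lemma expn4_le_prod k (z : 'I_k -> R) : (forall b, 0 <= z b <= 1) ->
  k%:R <= 2 * \sum_b z b -> 4 ^+ k <= \prod_b (1 + 15 * z b).
Proof.
move=> z01 kz.
have l16 : expR (ln 16) = 16 :> R by rewrite lnK// posrE.
have E : expR (\sum_b z b * ln 16) <= \prod_b (1 + 15 * z b).
  rewrite expR_sum; apply: ler_prod => b _; rewrite expR_ge0/=.
  have /andP[z0 z1] := z01 b.
  by have := expR_convex (ln 16) z0 z1; rewrite l16; lra.
apply: le_trans E.
(* The exponent [\sum_b z b] is at least [k / 2], and 16 to the power [k / 2] is [4 ^+ k]. *)
have l4 : ln 16 = ln 4 *+ 2 :> R.
  by rewrite -lnXn//; congr ln; rewrite expr2; lra.
have -> : 4 ^+ k = expR (k%:R * ln 4) :> R.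
  by rewrite expRM_natl lnK// posrE.
rewrite ler_expR -mulr_suml l4.
have : 0 <= ln 4 :> R by rewrite ln_ge0//; lra.
rewrite mulr2n => l0.
have := ler_wpM2r l0 kz; lra.
Qed.

(** Markov's inequality for the product of [1 + 15 * z] over the blocks: by independence its
    expectation is at most [(1 + 15 / 16) ^+ k], hence at most [2 ^+ k], whereas on [A] the product
    is at least [4 ^+ k]. *)
Lemma iid_chernoff m r k (z : seq T -> R) :
  seq_measurable z -> (forall s, 0 <= z s <= 1) ->
  (iidE nu m (EFin \o z) <= (16^-1)%:E)%E ->
  forall d' (Omega : measurableType d') (P : probability Omega R)
    (X : 'I_(k * m + r) -> {RV P >-> T}),
  (forall B : 'I_(k * m + r) -> set T, (forall i, measurable (B i)) ->
     P [set w | forall i, B i (X i w)] = \prod_(i < k * m + r) nu (B i))%E ->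
  let A := [set w |
    k%:R <= 2 * \sum_(b < k) z (block m [tuple X i w | i < k * m + r] b)] in
  measurable A /\ (P A <= (2 ^- k)%:E)%E.
Proof.
move=> mz z01 Ez d' Omega P X HX A.
pose Y w : (k * m + r).-tuple T := [tuple X i w | i < k * m + r].
pose S (t : seq T) := 2 * \sum_(b < k) z (block m t b).
have mS : seq_measurable S.
  move=> n; apply: measurable_funM => //; apply: measurable_sum => b.
  exact: seq_measurable_block.
have mY : measurable_fun setT Y by exact: measurable_mktuple.
have mA : measurable A.
  rewrite -[A]setTI; have mSY : measurable_fun setT (fun w => S (Y w)).
    exact: (measurableT_comp (mS (k * m + r)%N) mY).
  rewrite (_ : A = (fun w => S (Y w)) @^-1` `[k%:R, +oo[%classic).
    exact: mSY.
  by apply/seteqP; split => w /=; rewrite in_itv/= andbT.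
split => //.
pose G (s : seq T) : \bar R := (1 + 15 * z s)%:E.
have G0 s : (0 <= G s)%E.
  by rewrite lee_fin addr_ge0// mulr_ge0//; case/andP: (z01 s).
have mG : seq_measurable G.
  move=> n; apply/measurable_EFinP/measurable_funD => //.
  by apply: measurable_funM => //; exact: mz.
pose W (s : seq T) := (\prod_(b < k) G (block m s b))%E.
have mW : seq_measurable W by exact: seq_measurable_prod_block.
have W0 s : (0 <= W s)%E by exact: prode_ge0.
have EG : (iidE nu m G <= 2%:E)%E.
  have -> : iidE nu m G = (1 + 15%:E * iidE nu m (EFin \o z))%E.
    rewrite /iidE -ge0_integralZl//; last 2 first.
    - by apply/measurable_EFinP; exact: mz.
    - by move=> t _; rewrite lee_fin; case/andP : (z01 t).
    rewrite -[X in (X + _)%E](iidE_cst nu m) -ge0_integralD//.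
    - by move=> t _; rewrite mule_ge0// lee_fin; case/andP : (z01 t).
    - by apply: emeasurable_funM => //; apply/measurable_EFinP; exact: mz.
  apply: (@le_trans _ _ (1 + 15%:E * (16^-1)%:E)%E).
    by apply: leeD2l; apply: lee_wpmul2l => //; rewrite lee_fin.
  by rewrite -EFinM -EFinD lee_fin; lra.
have EW : (\int[P]_w W (Y w) <= (2 ^+ k)%:E)%E.
  rewrite (integral_iid HX (F := fun t => W t))//.
  rewrite -/(iidE nu (k * m + r) W) iidE_prod_block// EFin_expe.
  elim: (k) => // l IHl; rewrite !expeS; apply: lee_pmul => //.
    exact: iidE_ge0.
  by rewrite expe_ge0// iidE_ge0.
have lowA : ((4 ^+ k)%:E * P A <= \int[P]_w W (Y w))%E.
  apply: (@le_trans _ _ (\int[P]_(w in A) W (Y w))%E); last first.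
    apply: ge0_subset_integral => //.
    exact: measurableT_comp (mW _) mY.
  rewrite -integral_cst//; apply: ge0_le_integral => //.
  - by move=> w _; rewrite lee_fin exprn_ge0.
  - apply: measurable_funTS; exact: measurableT_comp (mW _) mY.
  - move=> w Aw; rewrite /W /G /cst/= prodEFin lee_fin.
    by apply: expn4_le_prod => // b; exact: z01.
rewrite -(@lee_pmul2l _ (4 ^+ k)%:E) ?lte_fin ?exprn_gt0//.
apply: le_trans lowA _; apply: le_trans EW _.
by rewrite -EFinM lee_fin -exprVn -exprMn lerXn2r ?nnegrE//; lra.
Qed.

End concentration.

(** * The two estimators and their guarantees *)

Section estimators.
Context d (T : measurableType d) (R : realType) (mu : {measure set T -> \bar R}).
Variables (M : nat) (p : 'I_M -> T -> R).
Hypothesis dp : forall i, is_density mu (p i).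
Hypothesis M_gt0 : (0 < M)%N.

Let mp i : measurable_fun setT (p i). Proof. by case: (dp i). Qed.
Let p0 i x : 0 <= p i x. Proof. by case: (dp i) => _ + _; exact. Qed.

(** The bound holds for every sample: it is [bayes_risk_step] at the empty list, where
    [log_posterior] equals [ln M%:R]. *)
Lemma guarantees_uniform_mixture n (delta : R) : 0 < delta ->
  density_estimator mu (fun _ : n.-tuple T => bayes p [::]) /\
  guarantees mu p delta (fun _ : n.-tuple T => bayes p [::]) (ln M%:R)%:E.
Proof.
move=> delta0.
have bayes0 y : 0 <= bayes p [::] y by exact: bayes_ge0 dp _ _.
have mbayes : measurable_fun setT (bayes p [::]) by exact: measurable_bayes dp _.
have ibayes : (\int[mu]_y (bayes p [::] y)%:E = 1)%E.
  by apply: integral_bayes dp _ _; rewrite evidence_nil ltr0n.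
split => // j d' Omega P X _; exists setT; split => //; last first.
  by rewrite probability_setT lee_fin; lra.
move=> w _ /=.
(* The shape expected by [KL_normalized_le], with [Z = 1]. *)
rewrite (_ : bayes p [::] = fun y => bayes p [::] y / 1); last first.
  by apply/funext => y; rewrite divr1.
apply: (@le_trans _ _ (bayes_risk mu p j [::])).
  apply: (KL_normalized_le (c := M%:R^-1)) => //.
  - by rewrite invr_gt0 ltr0n.
  - exact: bayes_nil_ge dp _.
rewrite -(log_posterior_nil p j); apply: le_trans (bayes_risk_step dp _ _).
by rewrite leeDl// integral_ge0// => y _; exact: log_posterior_ge0.
Qed.

Definition median_mixture k m (s : seq T) (y : T) : R :=
  median (fun b : 'I_k => bayes_avg p m (block m s b) y).

(** A pointwise median of densities need not have mass 1. For [0 < k] its mass is positive and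
    finite, so [fine] loses nothing. *)
Definition median_estimator k m n (t : n.-tuple T) (y : T) : R :=
  median_mixture k m t y / fine (\int[mu]_x (median_mixture k m t x)%:E)%E.

Lemma median_mixture_ge0 k m s y : 0 <= median_mixture k m s y.
Proof. by apply: median_ge0 => b; exact: bayes_avg_ge0 dp _ _ _. Qed.

Lemma measurable_median_mixture k m s : measurable_fun setT (median_mixture k m s).
Proof. by apply: measurable_median => b; exact: measurable_bayes_avg dp _ _. Qed.

Lemma median_mixture_ge k m s i y : (0 < k)%N ->
  (m.+1%:R * M%:R)^-1 * p i y <= median_mixture k m s y.
Proof.
move=> k0; apply: le_median => // b; first exact: bayes_avg_ge0 dp _ _ _.
exact: bayes_avg_ge dp _ _ _ _.
Qed.

Lemma integral_median_mixture_lty k m s :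
  (\int[mu]_y (median_mixture k m s y)%:E < +oo)%E.
Proof.
apply: (@le_lt_trans _ _
    (\int[mu]_y \sum_(b < k) (bayes_avg p m (block m s b) y)%:E)%E).
  apply: ge0_le_integral => //.
  - by move=> y _; rewrite lee_fin median_mixture_ge0.
  - by apply/measurable_EFinP; exact: measurable_median_mixture.
  - apply: emeasurable_sum => b; apply/measurable_EFinP.
    exact: measurable_bayes_avg dp _ _.
  - by move=> y _; rewrite sumEFin lee_fin; exact: median_le_sum.
rewrite ge0_integral_sum//; last 2 first.
- by move=> b; apply/measurable_EFinP; exact: measurable_bayes_avg dp _ _.
- by move=> b y _; rewrite lee_fin; exact: bayes_avg_ge0 dp _ _ _.
by apply/lte_sum_pinfty => b _; exact: integral_bayes_avg_lty dp _ _.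
Qed.

Lemma integral_median_mixture_gt0 k m s : (0 < k)%N ->
  (0 < \int[mu]_y (median_mixture k m s y)%:E)%E.
Proof.
move=> k0; have [_ _ ip] := dp (Ordinal M_gt0).
have c0 : 0 < (m.+1%:R * M%:R)^-1 :> R by rewrite invr_gt0 mulr_gt0 ?ltr0n.
apply: (@lt_le_trans _ _ ((m.+1%:R * M%:R)^-1%:E)%E); first by rewrite lte_fin.
rewrite -[leLHS]mule1 -ip -ge0_integralZl ?lee_fin ?(ltW c0)//; last 2 first.
- exact/measurable_EFinP.
- by move=> y _; rewrite lee_fin.
apply: ge0_le_integral => //.
- by move=> y _; rewrite -EFinM lee_fin mulr_ge0// ltW.
- by apply/measurable_EFinP; exact: measurable_funM.
- by apply/measurable_EFinP; exact: measurable_median_mixture.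
- by move=> y _; rewrite -EFinM lee_fin; exact: median_mixture_ge.
Qed.

Lemma density_estimator_median k m n : (0 < k)%N ->
  density_estimator mu (@median_estimator k m n).
Proof.
move=> k0 t; have Z0 := integral_median_mixture_gt0 m t k0.
have Zy := integral_median_mixture_lty k m t.
set Z := (\int[mu]_y _)%E in Z0 Zy.
have ZE : Z = (fine Z)%:E by rewrite fineK// ge0_fin_numE// ltW.
have z0 : 0 < fine Z by rewrite fine_gt0// Z0.
split.
- by apply: measurable_funM => //; exact: measurable_median_mixture.
- by move=> y; rewrite divr_ge0 ?median_mixture_ge0// ltW.
- rewrite /median_estimator -/Z; under eq_integral do rewrite mulrC EFinM.
  rewrite ge0_integralZl ?lee_fin ?invr_ge0 ?(ltW z0)//; last 2 first.
  + by apply/measurable_EFinP; exact: measurable_median_mixture.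
  + by move=> y _; rewrite lee_fin median_mixture_ge0.
  by rewrite -/Z ZE -EFinM mulVf// gt_eqF.
Qed.

Lemma guarantees_median k m r (delta : R) : (0 < k)%N -> (1 < M)%N ->
  2 ^- k <= delta ->
  guarantees mu p delta (@median_estimator k m (k * m + r))
    (16 * (ln M%:R / m.+1%:R))%:E.
Proof.
move=> k0 M1 kdelta j d' Omega P X [Xind Xlaw].
(* Sixteen times the bound on the expected block risk, so that the truncated risk has mean at most
   [16^-1], as [iid_chernoff] requires. *)
set rho := 16 * _.
have rho0 : 0 < rho.
  by rewrite mulr_gt0// divr_gt0 ?ltr0n// ln_gt0// ltr1n.
pose e (s : seq T) := bayes_avg_risk mu p j m s.
have e0 s : (0 <= e s)%E by exact: bayes_avg_risk_ge0 dp _ _ _.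
pose z s := truncated rho (e s).
have mz : seq_measurable z.
  move=> N; apply: (measurableT_comp (f := fine)
    (g := fun t : N.-tuple T => mine (rho^-1%:E * e t)%E 1%E)) => //.
  apply: measurable_mine => //.
  apply: emeasurable_funM => //; exact: seq_measurable_bayes_avg_risk dp _ _ _.
have z01 s : 0 <= z s <= 1 by rewrite truncated_ge0// truncated_le1.
pose nu := density_probability (dp j).
have Ez : (iidE nu m (EFin \o z) <= (16^-1)%:E)%E.
  apply: (@le_trans _ _ (iidE nu m (fun s => rho^-1%:E * e s))%E).
    apply: ge0_le_integral => //.
    - by move=> t _; rewrite lee_fin; case/andP: (z01 t).
    - by apply/measurable_EFinP; exact: mz.
    - apply: emeasurable_funM => //; exact: seq_measurable_bayes_avg_risk dp _ _ _.
    - by move=> t _; exact: truncated_le.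
  rewrite iidEZl ?lee_fin ?invr_ge0 ?(ltW rho0)//; last first.
    exact: seq_measurable_bayes_avg_risk dp _ _.
  apply: (@le_trans _ _ (rho^-1%:E * (ln M%:R / m.+1%:R)%:E)%E).
    apply: lee_wpmul2l; first by rewrite lee_fin invr_ge0 ltW.
    exact: iidE_bayes_avg_risk.
  rewrite -EFinM lee_fin /rho invfM -mulrA mulVf ?mulr1//.
  by rewrite gt_eqF// divr_gt0 ?ltr0n// ln_gt0// ltr1n.
have HX (B : 'I_(k * m + r) -> set T) : (forall i, measurable (B i)) ->
    P [set w | forall i, B i (X i w)] = (\prod_(i < k * m + r) nu (B i))%E.
  by move=> mB; rewrite Xind//; apply: eq_bigr => i _; rewrite Xlaw.
have [mA PA] := iid_chernoff mz z01 Ez HX.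
set A := mkset _ in mA PA.
exists (~` A); split; first exact: measurableC.
  move=> w /negP; rewrite -ltNge => Aw /=.
  set t : (k * m + r).-tuple T := [tuple X i w | i < _] in Aw *.
  have Z0 := integral_median_mixture_gt0 m t k0.
  have Zy := integral_median_mixture_lty k m t.
  apply: (@le_trans _ _ (\int[mu]_y kl_point (p j y) (median_mixture k m t y))%E).
    apply: (KL_normalized_le (c := (m.+1%:R * M%:R)^-1)) => //.
    - exact: measurable_median_mixture.
    - exact: median_mixture_ge0.
    - by rewrite invr_gt0 mulr_gt0 ?ltr0n.
    - by move=> y; exact: median_mixture_ge.
    - by rewrite fineK// ge0_fin_numE// ltW.
  apply: (integral_kl_point_median (e := fun b => e (block m t b))) => //.
  - by move=> b; exact: measurable_bayes_avg dp _ _.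
  - by move=> b y; exact: bayes_avg_ge0 dp _ _ _.
  - by move=> b; exact: kl_point_bayes_avg_le dp _ _ _.
rewrite probability_setC// EFinB leeB//.
by apply: le_trans PA _; rewrite lee_fin.
Qed.

End estimators.

(** The source of the constant: [1 / m <= k / n] and [k <= 2 * D] give [32 * L * D / n], which 75
    covers with room to spare. The block parameter [m] stands for the block length plus one. *)
Lemma block_rate_le (R : realFieldType) (L L2 D n m k l2 : R) :
  0 <= L -> L <= L2 -> 0 < n -> 0 < m -> 0 <= k -> n <= m * k ->
  1 / 2 <= l2 -> k * l2 <= D -> 16 * (L / m) <= 75 * L2 * D / n.
Proof.
move=> L0 LL2 n0 m0 k0 nmk l2ge kD.
have kD2 : k <= 2 * D by have := ler_wpM2l k0 l2ge; lra.
have D0 : 0 <= D by lra.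
rewrite ler_pdivlMr//; apply: (@le_trans _ _ (16 * (L * k))).
  rewrite -mulrA ler_wpM2l// mulrAC ler_pdivrMr// -mulrA ler_wpM2l//.
  by rewrite mulrC.
have h1 := ler_wpM2l L0 kD2; have h2 := ler_wpM2r D0 LL2.
have h3 := mulr_ge0 L0 D0; lra.
Qed.

Lemma kl_rate_upper_bound (R : realType) (M n : nat) (delta : R) :
  (2 <= M)%N -> (1 <= n)%N -> 0 < delta -> delta < 1 ->
  forall (d : measure_display) (T : measurableType d)
    (mu : {measure set T -> \bar R}) (p : 'I_M -> T -> R),
  (forall j, is_density mu (p j)) ->
  exists phat : n.-tuple T -> T -> R,
    density_estimator mu phat /\
    guarantees mu p delta phat (kl_rate M n delta)%:E.
Proof.
move=> M2 n1 delta0 delta1 d T mu p dp; have M0 : (0 < M)%N by exact: ltn_trans M2.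
rewrite /kl_rate; set rate := (75%:R * _ * _ / _).
case: (leP rate (ln M%:R)) => _; last first.
  by exists (fun=> bayes p [::]); exact: guarantees_uniform_mixture.
have ln2 : 1 / 2 <= ln 2 :> R.
  have := @ln_le_subr1 R (2^-1); rewrite lnV ?posrE// => /(_ _).
  by move=> /(_ ltac:(by rewrite invr_gt0)); lra.
have ld0 : 0 <= ln delta^-1 by rewrite ln_ge0// invf_ge1// ltW.
(* The least integer above the binary logarithm of [delta^-1]: large enough for [2 ^- k <= delta],
   small enough for [k%:R * ln 2 <= ln (2 / delta)]. *)
pose k := (Num.truncn (ln delta^-1 / ln 2)).+1.
have k0 : (0 < k)%N by [].
have kE : k%:R = (Num.truncn (ln delta^-1 / ln 2))%:R + 1 :> R by rewrite natr1.
have x0 : 0 <= ln delta^-1 / ln 2 by rewrite divr_ge0//; lra.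
have k_le : k%:R * ln 2 <= ln (2 / delta).
  move: x0; rewrite -truncn_le ler_pdivlMr; last by lra.
  by rewrite lnM ?posrE ?invr_gt0// kE mulrDl mul1r; lra.
have kdelta : 2 ^- k <= delta.
  have : ln delta^-1 < k%:R * ln 2.
    by rewrite -ltr_pdivrMr; [by rewrite truncnS_gt|lra].
  rewrite mulr_natl -lnXn// ltr_ln ?posrE ?invr_gt0 ?exprn_gt0// => h.
  by rewrite -[leRHS]invrK lef_pV2 ?posrE ?exprn_gt0 ?invr_gt0// ltW.
(* If [k] exceeds [n], the blocks are empty and every block average is the uniform mixture; the
   estimate still holds, since it involves only [m.+1], which exceeds [n / k]. *)
pose m := (n %/ k)%N.
have mk : n%:R <= m.+1%:R * k%:R :> R.
  by rewrite -natrM ler_nat ltnW// ltn_ceil.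
have rate_le : 16 * (ln M%:R / m.+1%:R) <= rate.
  have M0' : 0 < M%:R :> R by rewrite ltr0n.
  apply: (@block_rate_le R (ln M%:R) (ln (2 * M%:R)) (ln (2 / delta))
    n%:R m.+1%:R k%:R (ln 2)) => //; rewrite ?ltr0n//.
  - by rewrite ln_ge0// ler1n.
  - by rewrite ler_ln ?posrE ?mulr_gt0// ler_peMl// ?ler1n// ltW.
have [phat [dphat gphat]] : exists phat : n.-tuple T -> T -> R,
    density_estimator mu phat /\
    guarantees mu p delta phat (16 * (ln M%:R / m.+1%:R))%:E.
  have nE : n = (k * m + n %% k)%N by rewrite mulnC -divn_eq.
  (* Quotient and remainder are generalized so that [n] can be replaced in the type of the
     sample. *)
  move: m (n %% k)%N nE {mk rate_le} => m r ->.
  exists (@median_estimator _ _ _ mu _ p k m _).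
  by split; [exact: density_estimator_median|exact: guarantees_median].
exists phat; split => // j d' Omega P X iX.
have [E [mE EA PE]] := gphat j d' Omega P X iX.
by exists E; split => // w /EA /= /le_trans; apply; rewrite lee_fin.
Qed.

(** * Lower bound *)

Section counting.
Context (R : realType).
Implicit Types f q : nat -> R.
Local Notation mu := (@counting nat R).

Lemma integral_counting_support N f : (forall x, (N <= x)%N -> f x = 0) ->
  (\int[mu]_x (f x)%:E = (\sum_(x < N) f x)%:E)%E.
Proof.
move=> fN.
have finsum g : (forall x, (N <= x)%N -> g x = 0) ->
    (\sum_(k <oo) (g k)%:E = (\sum_(x < N) g x)%:E :> \bar R)%E.
  move=> gN; apply/cvg_lim => //; apply: cvg_near_cst.
  exists N => // n /= Nn.
  rewrite (@big_cat_nat _ _ _ N)//= [X in (_ + X)%E]big1_seq ?adde0.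
    by rewrite big_mkord sumEFin.
  by move=> k /andP[_]; rewrite mem_index_iota => /andP[/gN ->].
rewrite integral_count ?finsum//.
rewrite /summable -nneseries_esumT => [|//].
under eq_eseriesr do rewrite abse_EFin.
rewrite finsum ?ltry// => x /fN ->; exact: normr0.
Qed.

Lemma density_law_counting_set1 f x : density_law mu f [set x] = (f x)%:E.
Proof.
rewrite /density_law integral_mkcond/=.
rewrite (eq_integral (fun y => ((if y == x then f x else 0)%:E))).
  rewrite (@integral_counting_support x.+1) => [|y]; last first.
    by rewrite ltn_neqAle eq_sym => /andP[/negbTE ->].
  rewrite big_ord_recr/= eqxx big1 ?add0r// => i _.
  by rewrite ltn_eqF.
move=> y _; rewrite patchE; case: eqVneq => [->|yx].
  by rewrite mem_set.
by rewrite memNset//= => /eqP; rewrite (negbTE yx).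
Qed.

Lemma density_counting_sum_le1 q N : is_density mu q -> \sum_(x < N) q x <= 1.
Proof.
move=> [_ q0 iq]; rewrite -lee_fin -iq.
rewrite (_ : \sum_(x < N) q x = \sum_(x < N) (if (x < N)%N then q x else 0)).
  rewrite -(@integral_counting_support N (fun x => if (x < N)%N then q x else 0));
    last by move=> x; rewrite leqNgt => /negbTE ->.
  apply: ge0_le_integral => // x _; first by rewrite lee_fin; case: ifP.
  by rewrite lee_fin; case: ifP.
by apply: eq_bigr => i _; rewrite ltn_ord.
Qed.

End counting.

Section spiked.
Context (R : realType) (M : nat) (eps : R).
Hypothesis eps0 : 0 < eps.
Hypothesis eps1 : eps < 1.
Local Notation mu := (@counting nat R).

Definition spiked (j : 'I_M) (x : nat) : R :=
  if x == 0%N then 1 - eps else if x == j.+1 then eps else 0.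

Lemma sum_spiked (F : nat -> R -> R) j : (forall x, F x 0 = 0) ->
  \sum_(x < M.+1) F x (spiked j x) = F 0%N (1 - eps) + F j.+1 eps.
Proof.
move=> F0; rewrite big_ord_recl; congr (_ + _).
rewrite (bigD1 j)//= {1}/spiked/= eqxx big1 ?addr0// => i ij.
by rewrite /spiked/= eqSS (inj_eq val_inj) (negbTE ij) F0.
Qed.

Lemma spiked_support j x : (M < x)%N -> spiked j x = 0.
Proof.
move=> Mx; rewrite /spiked gtn_eqF ?(leq_trans _ Mx)// ifN//.
by rewrite gtn_eqF// (leq_ltn_trans (ltn_ord j)).
Qed.

Lemma is_density_spiked j : is_density mu (spiked j).
Proof.
split => //.
  move=> x; rewrite /spiked; case: (x == 0%N); first by rewrite subr_ge0 ltW.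
  by case: (x == j.+1) => //; exact: ltW.
rewrite (integral_counting_support (N := M.+1)); last exact: spiked_support.
by rewrite (sum_spiked (F := fun _ y => y))// subrK.
Qed.

Lemma distinct_laws_spiked : distinct_laws mu spiked.
Proof.
move=> i j ij; exists [set i.+1] => //; rewrite !density_law_counting_set1.
by rewrite /spiked/= eqxx eqSS (inj_eq val_inj) (negbTE ij) => -[] /eqP; rewrite gt_eqF.
Qed.

(** By pigeonhole some private point satisfies [M%:R * q j.+1 <= 1 - q 0]. The inequality
    [a - c <= a * ln (a / c)], applied at 0 with [c = q 0] and at the private point with
    [c = M%:R * q j.+1], has lower bounds with nonnegative sum; the factor [M%:R] in the logarithm
    accounts for [eps * ln M%:R]. *)
Lemma exists_spiked_KL_ge q : (0 < M)%N -> is_density mu q ->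
  exists j, ((eps * ln M%:R)%:E <= KL mu (spiked j) q)%E.
Proof.
move=> M0 dq; have [_ q0 _] := dq; have := density_counting_sum_le1 M.+1 dq.
rewrite big_ord_recl => sq.
have [j qj] : exists j : 'I_M, M%:R * q j.+1 <= 1 - q 0%N.
  apply: contrapT => /forallNP qj.
  have : \sum_(j < M) (1 - q 0%N) < \sum_(j < M) (M%:R * q j.+1).
    have lt_j (j : 'I_M) : 1 - q 0%N < M%:R * q j.+1.
      by rewrite ltNge; apply/negP.
    rewrite (bigD1 (Ordinal M0))//= [ltRHS](bigD1 (Ordinal M0))//=.
    apply: ltr_leD; first exact: (lt_j (Ordinal M0)).
    by apply: ler_sum => j _; exact: ltW.
  rewrite -mulr_sumr sumr_const card_ord -[X in X < _]mulr_natl ltr_pM2l ?ltr0n//.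
  by rewrite ltNge lerBrDl; move: sq => /= -> .
exists j; rewrite /KL; case: asboolP => [dom|_]; last exact: leey.
(* Absolute continuity tested on singletons, so that no logarithm below involves a division by 0. *)
have qpos x : 0 < spiked j x -> 0 < q x.
  move=> px; rewrite lt_def q0 andbT; apply/eqP => qx.
  have : density_law mu (spiked j) [set x] = 0%E.
    apply: (dom [set x]) => // B _ Bx; have [->|->] := subset_set1 Bx.
      exact: integral_set0.
    by rewrite density_law_counting_set1 qx.
  by rewrite density_law_counting_set1 => -[] px0; rewrite px0 ltxx in px.
have q00 : 0 < q 0%N by apply: qpos; rewrite /spiked eqxx/= subr_gt0.
have qj0 : 0 < q j.+1 by apply: qpos; rewrite /spiked/= eqxx.
rewrite (integral_counting_support (N := M.+1)) => [|x Mx]; last first.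
  by rewrite spiked_support// mul0r.
rewrite (sum_spiked (F := fun x y => y * ln (y / q x))) => [|x]; last by rewrite mul0r.
rewrite lee_fin.
have gibbs (a c : R) : 0 < a -> 0 < c -> a - c <= a * ln (a / c).
  move=> a0 c0; have := kl_point_ge0 (ltW a0) (ltW c0).
  by rewrite kl_point_fin// lee_fin; lra.
have e1 : 0 < 1 - eps by rewrite subr_gt0.
have Mq : 0 < M%:R * q j.+1 by rewrite mulr_gt0 ?ltr0n.
have := gibbs _ _ e1 q00; have := gibbs _ _ eps0 Mq.
have -> : ln (eps / (M%:R * q j.+1)) = ln (eps / q j.+1) - ln M%:R.
  rewrite !ln_div ?posrE ?divr_gt0 ?ltr0n// lnM ?posrE ?ltr0n//; ring.
rewrite mulrBr; lra.
Qed.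

End spiked.

Section iid_coordinates.
Context d (T : measurableType d) (R : realType) (mu : {measure set T -> \bar R}).
Variables (p : T -> R) (dp : is_density mu p) (n : nat).

Let nu := density_probability dp.

Definition coordinate (i : 'I_n) (t : n.-tuple T) : T := tnth t i.

Let measurable_coordinate i : measurable_fun setT (coordinate i).
Proof. exact: measurable_tnth. Qed.

HB.instance Definition _ i :=
  isMeasurableFun.Build _ _ _ _ (coordinate i) (measurable_coordinate i).

Definition coordinate_RV (i : 'I_n) : {RV (iid_law nu n) >-> T} := coordinate i.

(** A concrete i.i.d. sample, to which the guarantee of an estimator is applied in the lower
    bound. *)
Lemma iid_with_density_coordinate : iid_with_density mu p coordinate_RV.
Proof.
have marg (i : 'I_n) (A : set T) : measurable A ->
    iid_law nu n (coordinate_RV i @^-1` A) = nu A.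
  move=> mA; pose B l := if l == i then A else setT.
  have mB l : measurable (B l) by rewrite /B; case: ifP.
  rewrite (_ : _ @^-1` A = [set t | forall l, B l (tnth t l)]); last first.
    apply/seteqP; split => [t At l|t /(_ i)]; last by rewrite /B eqxx.
    by rewrite /B; case: eqP => [->|].
  rewrite iid_law_box// (bigD1 i)//= {1}/B eqxx big1 ?mule1// => l li.
  by rewrite /B (negbTE li) probability_setT.
split => // B mB; rewrite [LHS](iid_law_box nu mB).
by apply: eq_bigr => i _; rewrite marg.
Qed.

End iid_coordinates.

Section spiked_guarantee.
Context (R : realType) (M : nat) (eps : R).
Hypothesis eps0 : 0 < eps.
Hypothesis eps1 : eps < 1.
Hypothesis M0 : (0 < M)%N.
Local Notation mu := (@counting nat R).

(* With probability larger than [delta] the sample is identically 0, whatever the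
   true density, so a single density has to suit all of them. *)
Lemma spiked_guarantees_ge n (delta : R) (phat : n.-tuple nat -> nat -> R) b :
  delta < (1 - eps) ^+ n -> density_estimator mu phat ->
  guarantees mu (@spiked R M eps) delta phat b -> ((eps * ln M%:R)%:E <= b)%E.
Proof.
move=> ltd dphat gphat; pose t0 : n.-tuple nat := [tuple 0%N | _ < n].
have [j le_j] := exists_spiked_KL_ge eps0 eps1 M0 (dphat t0).
apply: (le_trans le_j).
have dj := is_density_spiked eps0 eps1 j.
have [E [mE EA PE]] := gphat j _ _ _ _ (iid_with_density_coordinate dj n).
have Et0 : E t0.
  (* An event that misses the zero sample has probability at most [1 - (1 - eps) ^+ n], which is
     less than [1 - delta]. *)
  apply: contrapT => nE; move: PE; apply/negP; rewrite -ltNge.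
  pose B := [set t : n.-tuple nat | forall i, [set 0%N] (tnth t i)].
  have mB : measurable B by exact: (@measurable_tuple_box _ _ n (fun=> [set 0%N])).
  have EB : E `<=` ~` B.
    move=> t Et Bt; apply: nE; rewrite (_ : t0 = t)//.
    by apply: eq_from_tnth => i; rewrite tnth_mktuple Bt.
  apply: (@le_lt_trans _ _ (iid_law (density_probability dj) n (~` B))).
    by apply: le_measure => //; rewrite inE//; exact: measurableC.
  rewrite probability_setC// (iid_law_box _ (B := fun=> [set 0%N]))//.
  have nu0 : density_probability dj [set 0%N] = (1 - eps)%:E.
    by rewrite [LHS]density_law_counting_set1.
  under eq_bigr do rewrite nu0.
  by rewrite prodEFin prodr_const card_ord -EFinB lte_fin ltrD2l ltrN2.
have := EA _ Et0; rewrite /= (_ : [tuple _ | _ < n] = t0)//.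
by apply: eq_from_tnth => i; rewrite tnth_mktuple.
Qed.

End spiked_guarantee.

(** For [1 <= y] the spike [(1 - expR (- y)) / 2] is at least [1 / 4], and the minimum is bounded by
    [L]; for [y <= 1] it is at least [y / 4], and the minimum is bounded by [rate]. Both follow from
    [expR (- y) * (1 + y) <= 1]. *)
Lemma spike_rate_ge (R : realType) (L y K rate : R) :
  0 <= L -> 0 < y -> 1 <= K -> rate <= K * y * L ->
  (4 * K)^-1 * Num.min rate L <= (1 - expR (- y)) / 2 * L.
Proof.
move=> L0 y0 K1 rateK; have e0 := expR_gt0 (- y).
have e1 : expR (- y) * (1 + y) <= 1.
  have := ler_wpM2l (ltW e0) (expR_ge1Dx y).
  by rewrite -expRD addNr expR0.
have K0 : 0 < 4 * K by lra.
rewrite mulrC ler_pdivrMr//.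
have [y1|/ltW y1] := leP 1 y.
  have e2 : expR (- y) <= 1 / 2.
    have := ler_wpM2l (ltW e0) y1; lra.
  have e3 : 1 <= (1 - expR (- y)) / 2 * (4 * K).
    have : 1 * 1 <= ((1 - expR (- y)) * 2) * K by apply: ler_pM; lra.
    by lra.
  apply: (@le_trans _ _ L); first by rewrite ge_min lexx orbT.
  by have := ler_wpM2r L0 e3; lra.
have e2 : y / 2 <= 1 - expR (- y).
  have : expR (- y) * (1 + y) <= (1 - y / 2) * (1 + y).
    by apply: (le_trans e1); have := mulr_ge0 (ltW y0) (_ : 0 <= 1 - y); lra.
  by rewrite ler_pM2r; lra.
apply: (@le_trans _ _ (K * y * L)); first by rewrite ge_min rateK.
have KL0 : 0 <= K * L by rewrite mulr_ge0//; lra.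
by have := ler_wpM2r KL0 e2; lra.
Qed.

(** Absorbs the two terms [ln 2] of the rate: one into [L = ln M%:R], the other into
    [l = ln delta^-1], at the price of a factor depending on [l0 = ln delta0^-1]. *)
Lemma kl_rate_le (R : realFieldType) (L n l2 l0 l : R) :
  0 < n -> 0 < l2 -> l2 <= L -> 0 < l0 -> l0 <= l ->
  75 * (l2 + L) * (l2 + l) / n <= 150 * (1 + l2 / l0) * (l / n) * L.
Proof.
move=> n0 l20 l2L l00 l0l.
rewrite (_ : 150 * _ * _ * L = 150 * (1 + l2 / l0) * l * L / n); last first.
  by rewrite mulrA -!mulrA (mulrC n^-1).
rewrite ler_wpM2r ?invr_ge0 ?(ltW n0)//.
have h : l2 <= l2 / l0 * l by rewrite mulrAC ler_pdivlMr// ler_wpM2l// ltW.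
apply: (@le_trans _ _ (75 * (2 * L) * (l2 / l0 * l + l))); last by lra.
by apply: ler_pM; lra.
Qed.

Lemma kl_rate_lower_bound (R : realType) (delta0 : R) : 0 < delta0 -> delta0 < 1 ->
  exists2 c : R, 0 < c &
   forall (M n : nat) (delta : R),
     (2 <= M)%N -> (1 <= n)%N -> 0 < delta -> delta <= delta0 ->
   exists (d : measure_display) (T : measurableType d)
     (mu : {measure set T -> \bar R}) (p : 'I_M -> T -> R),
     [/\ (forall j, is_density mu (p j)), distinct_laws mu p &
      forall (phat : n.-tuple T -> T -> R) (b : \bar R),
        density_estimator mu phat -> guarantees mu p delta phat b ->
        ((c * kl_rate M n delta)%:E <= b)%E].
Proof.
move=> d00 d01; have l0 : 0 < ln delta0^-1 by rewrite ln_gt0// invf_gt1.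
have l2 : 0 <= ln 2 :> R by rewrite ln_ge0// ler1n.
pose K : R := 150 * (1 + ln 2 / ln delta0^-1).
have K1 : 1 <= K by have := divr_ge0 l2 (ltW l0); rewrite /K; lra.
exists (4 * K)^-1; first by rewrite invr_gt0; lra.
move=> M n delta M2 n1 dl0 dl.
have n0 : 0 < n%:R :> R by rewrite ltr0n.
have ld : ln delta0^-1 <= ln delta^-1 by rewrite ler_ln ?posrE ?invr_gt0// lef_pV2.
(* Thus [expR (- y)] is the [n]-th root of [delta]. Halving [1 - expR (- y)] in [eps] makes
   [delta < (1 - eps) ^+ n] strict. *)
pose y := ln delta^-1 / n%:R.
have y0 : 0 < y by rewrite divr_gt0// (lt_le_trans l0).
pose eps := (1 - expR (- y)) / 2.
have ey1 : expR (- y) < 1 by rewrite expR_lt1 oppr_lt0.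
have ey0 := expR_gt0 (- y).
have eps0 : 0 < eps by rewrite /eps; lra.
have eps1 : eps < 1 by rewrite /eps; lra.
have deps : delta < (1 - eps) ^+ n.
  have -> : delta = expR (- y) ^+ n.
    rewrite -expRM_natl mulrN mulrC divfK ?gt_eqF// lnV ?posrE// opprK lnK//.
  have lt_e : expR (- y) < 1 - eps by rewrite /eps; lra.
  by rewrite ltrXn2r ?(ltW ey0)// -lt0n.
exists _, nat, counting, (@spiked R M eps); split.
- exact: is_density_spiked.
- exact: distinct_laws_spiked.
move=> phat b dphat gphat.
apply: le_trans (spiked_guarantees_ge eps0 eps1 (ltnW M2) deps dphat gphat).
have L0 : 0 <= ln M%:R :> R by rewrite ln_ge0// ler1n ltnW.
rewrite lee_fin; apply: spike_rate_ge => //.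
have M0 : 0 < M%:R :> R by rewrite ltr0n ltnW.
have di0 : 0 < delta^-1 by rewrite invr_gt0.
rewrite lnM ?posrE// lnM ?posrE//.
apply: kl_rate_le => //; first by rewrite ln_gt0// ltr1n.
by rewrite ler_ln ?posrE// ler_nat.
Qed.

Theorem theorem1 (R : realType) :
  (forall (M n : nat) (delta : R),
     (2 <= M)%N -> (1 <= n)%N -> 0 < delta -> delta < 1 ->
   forall (d : measure_display) (T : measurableType d)
     (mu : {measure set T -> \bar R}) (p : 'I_M -> T -> R),
     (forall j, is_density mu (p j)) ->
   exists phat : n.-tuple T -> T -> R,
     density_estimator mu phat /\
     guarantees mu p delta phat (kl_rate M n delta)%:E)
  /\
  (forall delta0 : R, 0 < delta0 -> delta0 < 1 ->
   exists2 c : R, 0 < c &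
   forall (M n : nat) (delta : R),
     (2 <= M)%N -> (1 <= n)%N -> 0 < delta -> delta <= delta0 ->
   exists (d : measure_display) (T : measurableType d)
     (mu : {measure set T -> \bar R}) (p : 'I_M -> T -> R),
     [/\ (forall j, is_density mu (p j)), distinct_laws mu p &
      forall (phat : n.-tuple T -> T -> R) (b : \bar R),
        density_estimator mu phat -> guarantees mu p delta phat b ->
        ((c * kl_rate M n delta)%:E <= b)%E]).
Proof. by split; [exact: kl_rate_upper_bound|exact: kl_rate_lower_bound]. Qed.
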